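(* Let $\pi\in\mathcal{P}_0$ be a given policy, $\pi_k(\cdot|x)=\mathcal{N}(P_kx,\Sigma_{\pi_k})$, and let $\{\Sigma_{x_k}\}_{k=0}^T$ be given by $$\Sigma_{x_{k+1}}=(A_k+B_kP_k)\Sigma_{x_k}(A_k+B_kP_k)^\top+B_k\Sigma_{\pi_k}B_k^\top,\ k\in\{0,\dots,T-1\},\qquad \Sigma_{x_0}=\Sigma_{\mathrm{ini}}.$$ Then the unique optimal prior of the mutual information optimal density control problem with fixed policy $\pi$ (that is, the unique minimizer of $\rho\mapsto J(\pi,\rho)$ over $\rho\in\mathcal{R}_0$) is $\rho^\pi=\{\rho_k^\pi\}_{k=0}^{T-1}$ given by $$\rho_k^\pi=\mathcal{N}\left(0,\ \Sigma_{\pi_k}+P_k\Sigma_{x_k}P_k^\top\right),\quad k\in\{0,\dots,T-1\}.$$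
   Context: Notation. $T\ge1$ is an integer, $A_k\in\mathbb{R}^{n\times n}$, $B_k\in\mathbb{R}^{n\times m}$ for $k\in\{0,\dots,T-1\}$, and $\Sigma_{\mathrm{ini}},\Sigma_{\mathrm{fin}}\succ0$ are $n\times n$. $\mathcal{N}(\mu,\Sigma)$ is the Gaussian distribution (and its density), $\mathcal{D}_{\mathrm{KL}}$ is the Kullback–Leibler divergence, $A\succ0$ means symmetric positive definite, $\mathrm{Im}$ is the image of a matrix. Policies and priors. A policy is $\pi=\{\pi_k\}_{k=0}^{T-1}$ with $\pi_k(\cdot|x)$ a conditional probability density on $\mathbb{R}^m$ given $x_k=x$; a prior is $\rho=\{\rho_k\}_{k=0}^{T-1}$ with $\rho_k$ a probability density on $\mathbb{R}^m$. Define $$\mathcal{R}_0:=\{\rho\mid\rho_k=\mathcal{N}(0,\Sigma_{\rho_k}),\ \Sigma_{\rho_k}\succ0\},$$ $$\mathcal{P}_0:=\{\pi\mid\pi_k(\cdot|x)=\mathcal{N}(P_kx,\Sigma_{\pi_k}),\ P_k\in\mathbb{R}^{m\times n},\ \Sigma_{\pi_k}\succ0,\ \mathrm{Im}(P_k)\subset\mathrm{Im}(\Sigma_{\pi_k})\}.$$ Mutual information optimal density control problem: minimize over $\pi$ and $\rho\in\mathcal{R}_0$ $$J(\pi,\rho):=\mathbb{E}\left[\sum_{k=0}^{T-1}\left\{\tfrac12\|u_k\|^2+\mathcal{D}_{\mathrm{KL}}[\pi_k(\cdot|x_k)\|\rho_k]\right\}\right]$$ subject to $x_{k+1}=A_kx_k+B_ku_k$,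 $u_k\sim\pi_k(\cdot|x)$ given $x=x_k$, $x_0\sim\mathcal{N}(0,\Sigma_{\mathrm{ini}})$, $x_T\sim\mathcal{N}(0,\Sigma_{\mathrm{fin}})$. The prior $\rho$ does not enter the dynamics or any of these constraints; with $\pi$ fixed, the expectation in $J(\pi,\rho)$ is taken under the process generated by $\pi$ from $x_0\sim\mathcal{N}(0,\Sigma_{\mathrm{ini}})$. *)

(* Defs.v *)
From HB Require Import structures.
From mathcomp Require Import all_boot all_order all_algebra.
From mathcomp Require Import all_classical all_reals all_analysis.

Set Implicit Arguments.
Unset Strict Implicit.
Unset Printing Implicit Defensive.

Import Order.TTheory GRing.Theory Num.Theory.
Import numFieldNormedType.Exports.

Local Open Scope classical_set_scope.
Local Open Scope ring_scope.

Definition measure_mx_display : measure_display.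
Proof. exact: default_measure_display. Qed.

(* Generators of the product (= Borel) sigma-algebra on matrices. *)
Definition entry_preimages (R : realType) (p q : nat) : set (set 'M[R]_(p, q)) :=
  [set X | exists i j (B : set (measurableTypeR R)),
     measurable B /\ X = (fun M : 'M[R]_(p, q) => M i j) @^-1` B].

Section measurable_mx.
Context (R : realType) (p q : nat).

Let mx_measurable : set (set 'M[R]_(p, q)) := <<s @entry_preimages R p q >>.

Let mx_measurable0 : mx_measurable set0.
Proof. exact: sigma_algebra0. Qed.

Let mx_measurableC A : mx_measurable A -> mx_measurable (~` A).
Proof. exact: sigma_algebraC. Qed.

Let mx_measurable_bigcup (F : (set 'M[R]_(p, q))^nat) :
  (forall i, mx_measurable (F i)) -> mx_measurable (\bigcup_i F i).
Proof. exact: sigma_algebra_bigcup. Qed.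

HB.instance Definition _ := @isMeasurable.Build measure_mx_display
  'M[R]_(p, q) mx_measurable mx_measurable0 mx_measurableC mx_measurable_bigcup.

End measurable_mx.

Lemma measurable_entry (R : realType) (p q : nat) (i : 'I_p) (j : 'I_q) :
  measurable_fun [set: 'M[R]_(p, q)]
    (fun M : 'M[R]_(p, q) => M i j : measurableTypeR R).
Proof.
move=> _ B mB; rewrite setTI; apply: sub_sigma_algebra.
by exists i, j, B.
Qed.

Lemma measurable_fun_mxP d (X : measurableType d) (R : realType) (p q : nat)
    (f : X -> 'M[R]_(p, q)) :
  measurable_fun [set: X] f <->
  forall i j, measurable_fun [set: X] (fun x => f x i j : measurableTypeR R).
Proof.
split=> [mf i j|mf].
  exact: (measurableT_comp (@measurable_entry R p q i j) mf).
apply: (@measurability _ _ X 'M[R]_(p, q) setT f (@entry_preimages R p q)) => //.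
move=> _ [_ [i [j [B [mB ->]]]] <-].
exact: (mf i j measurableT B mB).
Qed.

(* [lebesgue_cV] is built by recursion on the dimension: R^(n+1) is identified
   with R * R^n through [vcons], the first factor being the top coordinate. *)
Definition vcons (R : realType) (n : nat) (y : measurableTypeR R * 'cV[R]_n)
  : 'cV[R]_n.+1 := col_mx (y.1%:M : 'M[R]_1) y.2.

Definition vuncons (R : realType) (n : nat) (v : 'cV[R]_n.+1)
  : measurableTypeR R * 'cV[R]_n :=
  (usubmx (v : 'cV[R]_(1 + n)) 0 0, dsubmx (v : 'cV[R]_(1 + n))).

Lemma vconsK (R : realType) (n : nat) : cancel (@vcons R n) (@vuncons R n).
Proof.
by move=> [y v]; rewrite /vuncons /vcons col_mxKu col_mxKd mxE eqxx mulr1n.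
Qed.

Lemma measurable_vcons (R : realType) (n : nat) :
  measurable_fun [set: measurableTypeR R * 'cV[R]_n] (@vcons R n).
Proof.
apply/measurable_fun_mxP => i j; case: (@splitP 1 n i) => k ik.
  rewrite [X in measurable_fun _ X](_ : _ = fst); first exact: measurable_fst.
  apply/funext => y; rewrite (_ : i = @lshift 1 n k); last exact: val_inj.
  by rewrite [LHS]col_mxEu mxE !ord1 eqxx mulr1n.
rewrite [X in measurable_fun _ X](_ : _ =
    (fun v : 'cV[R]_n => v k j : measurableTypeR R) \o snd).
  exact: (measurableT_comp (@measurable_entry R n 1 k j) measurable_snd).
apply/funext => y; rewrite (_ : i = @rshift 1 n k); last exact: val_inj.
exact: col_mxEd.
Qed.

Lemma measurable_vuncons (R : realType) (n : nat) :
  measurable_fun [set: 'cV[R]_n.+1] (@vuncons R n).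
Proof.
apply/measurable_fun_pairP; split.
  rewrite [X in measurable_fun _ X](_ : _ =
      (fun v : 'cV[R]_(1 + n) => v (lshift n 0) 0 : measurableTypeR R)).
    exact: measurable_entry.
  by apply/funext => v; rewrite /vuncons /= mxE.
apply/measurable_fun_mxP => i j.
rewrite [X in measurable_fun _ X](_ : _ =
    (fun v : 'cV[R]_(1 + n) => v (rshift 1 i) j : measurableTypeR R)).
  exact: (@measurable_entry R n.+1 1).
by apply/funext => v; rewrite /= mxE.
Qed.

Definition lebesgue_vcons (R : realType) (n : nat)
    (mu : set 'cV[R]_n -> \bar R) : set 'cV[R]_n.+1 -> \bar R :=
  pushforward (@lebesgue_measure R \x mu)%E (@vcons R n).

Section lebesgue_vcons_measure.
Context (R : realType) (n : nat)
  (mu : {sigma_finite_measure set 'cV[R]_n -> \bar R}).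

Let lebesgue_vcons0 : lebesgue_vcons mu set0 = 0%E.
Proof. by rewrite /lebesgue_vcons /pushforward preimage_set0 measure0. Qed.

Let lebesgue_vcons_ge0 A : (0 <= lebesgue_vcons mu A)%E.
Proof. exact: integral_ge0. Qed.

Let lebesgue_vcons_sigma_additive : semi_sigma_additive (lebesgue_vcons mu).
Proof.
have mF := @measurable_vcons R n.
move=> G mG tG mUG; rewrite /lebesgue_vcons /pushforward preimage_bigcup.
apply: measure_semi_sigma_additive.
- by move=> k; rewrite -[X in measurable X]setTI; exact: mF.
- apply/trivIsetP => /= i j _ _ ij; rewrite -preimage_setI.
  by move/trivIsetP : tG => /(_ _ _ _ _ ij) ->//; rewrite preimage_set0.
- by rewrite -preimage_bigcup -[X in measurable X]setTI; apply: mF.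
Qed.

HB.instance Definition _ := isMeasure.Build _ _ _ (lebesgue_vcons mu)
  lebesgue_vcons0 lebesgue_vcons_ge0 lebesgue_vcons_sigma_additive.

Let lebesgue_vcons_sigma_finite : sigma_finite setT (lebesgue_vcons mu).
Proof.
have /sigma_finiteP[G [TG ndG Goo]] := sigma_finiteT (@lebesgue_measure R).
have /sigma_finiteP[H [TH ndH Hoo]] := sigma_finiteT mu.
exists (fun k => @vuncons R n @^-1` (G k `*` H k)).
  rewrite -preimage_bigcup (_ : \bigcup_k _ = setT) ?preimage_setT//.
  rewrite -setXTT TG TH predeqE => -[x y]; split.
    by move=> [i _ []/= ? ?]; split; exists i.
  move=> [/= [i _ Gix] [k _ Hky]]; exists (maxn i k) => //; split.
  - by move: x Gix; exact/subsetPset/ndG/leq_maxl.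
  - by move: y Hky; exact/subsetPset/ndH/leq_maxr.
move=> k; have [? ?] := Goo k; have [? ?] := Hoo k; split.
  rewrite -[X in measurable X]setTI; apply: measurable_vuncons => //.
  exact: measurableX.
rewrite /lebesgue_vcons /pushforward (_ : _ @^-1` _ = G k `*` H k).
  by rewrite product_measure1E// lte_mul_pinfty// ge0_fin_numE.
by rewrite -comp_preimage (_ : _ \o _ = id)//; apply/funext; exact: vconsK.
Qed.

HB.instance Definition _ := Measure_isSigmaFinite.Build _ _ _
  (lebesgue_vcons mu) lebesgue_vcons_sigma_finite.

End lebesgue_vcons_measure.

Fixpoint lebesgue_cV (R : realType) (n : nat)
    : {sigma_finite_measure set 'cV[R]_n -> \bar R} :=
  match n with
  | 0 => dirac (0 : 'cV[R]_0)
  | n'.+1 => lebesgue_vcons (@lebesgue_cV R n')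
  end.
Arguments lebesgue_cV {R n}.

Definition posdef (R : realType) (n : nat) (S : 'M[R]_n) : Prop :=
  S^T = S /\ forall v : 'cV[R]_n, v != 0 -> 0 < (v^T *m S *m v) 0 0.

Definition gauss (R : realType) (n : nat) (mu : 'cV[R]_n) (S : 'M[R]_n)
    (v : 'cV[R]_n) : R :=
  (Num.sqrt ((2 * pi) ^+ n * \det S))^-1
  * expR (- (2^-1 * ((v - mu)^T *m invmx S *m (v - mu)) 0 0)).

(* a * ln (a / b) with the usual conventions 0 * ln (0 / b) = 0 and
   a * ln (a / 0) = +oo for a != 0. *)
Definition kl_integrand (R : realType) (a b : R) : \bar R :=
  if a == 0 then 0%E else if b == 0 then +oo%E else (a * ln (a / b))%:E.

Definition KL (R : realType) (m : nat) (p q : 'cV[R]_m -> R) : \bar R :=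
  (\int[lebesgue_cV]_v kl_integrand (p v) (q v))%E.

(* Policies and priors are represented by their densities with respect to
   Lebesgue measure: [pol k x] is the density pi_k(. | x). *)
Definition policy (R : realType) (T n m : nat) : Type :=
  'I_T -> 'cV[R]_n -> 'cV[R]_m -> R.

Definition prior (R : realType) (T m : nat) : Type := 'I_T -> 'cV[R]_m -> R.

Definition R0 (R : realType) (T m : nat) : set (prior R T m) :=
  [set rho | exists S : 'I_T -> 'M[R]_m,
     forall k, posdef (S k) /\ rho k = gauss 0 (S k)].

(* Membership in the class of linear-Gaussian policies, with the gains and
   covariances that witness it made explicit. *)
Definition P0_with (R : realType) (T n m : nat) (P : 'I_T -> 'M[R]_(m, n))
    (S : 'I_T -> 'M[R]_m) (pol : policy R T n m) : Prop :=
  forall k, [/\ posdef (S k),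
    range (fun v : 'cV[R]_n => P k *m v)
      `<=` range (fun v : 'cV[R]_m => S k *m v) &
    forall x, pol k x = gauss (P k *m x) (S k)].

(* (x, u) is a state-control process generated by [pol] from N(0, Sini) on the
   probability space (Omega, Pr); states are meaningful for indices 0..T only.
   [process_control]: given x_k = x, u_k has conditional density [pol k x]. *)
Record process (R : realType) (T n m : nat)
    (A : 'I_T -> 'M[R]_n) (B : 'I_T -> 'M[R]_(n, m)) (Sini : 'M[R]_n)
    (pol : policy R T n m)
    (d : measure_display) (Omega : measurableType d) (Pr : probability Omega R)
    (x : nat -> {RV Pr >-> 'cV[R]_n}) (u : 'I_T -> {RV Pr >-> 'cV[R]_m})
    : Prop := Process {
  process_init : forall U : set 'cV[R]_n, measurable U ->
    distribution Pr (x 0%N) U =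
    (\int[lebesgue_cV]_(y in U) (gauss 0 Sini y)%:E)%E;
  process_dynamics : forall (k : 'I_T) (w : Omega),
    x k.+1 w = A k *m x k w + B k *m u k w;
  process_control : forall (k : 'I_T) (U : set 'cV[R]_n) (V : set 'cV[R]_m),
    measurable U -> measurable V ->
    Pr (x k @^-1` U `&` u k @^-1` V) =
    (\int[Pr]_(w in x k @^-1` U)
       \int[lebesgue_cV]_(v in V) (pol k (x k w) v)%:E)%E
}.

(* The library norm on matrices is the sup norm, hence the explicit sum. *)
Definition sqnorm2 (R : realType) (m : nat) (v : 'cV[R]_m) : R :=
  \sum_i v i 0 ^+ 2.

Definition J (R : realType) (T n m : nat)
    (d : measure_display) (Omega : measurableType d) (Pr : probability Omega R)
    (x : nat -> {RV Pr >-> 'cV[R]_n}) (u : 'I_T -> {RV Pr >-> 'cV[R]_m})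
    (pol : policy R T n m) (rho : prior R T m) : \bar R :=
  (\int[Pr]_w \sum_(k < T)
     ((2^-1 * sqnorm2 (u k w))%:E + KL (pol k (x k w)) (rho k)))%E.

Definition unique_minimizer (R : realType) (X : Type) (f : X -> \bar R)
    (D : set X) (a : X) : Prop :=
  [/\ D a, forall b, D b -> (f a <= f b)%E &
    forall b, D b -> (forall c, D c -> (f b <= f c)%E) -> b = a].

(* Main.v *)
Require Import Defs.
From HB Require Import structures.
From mathcomp Require Import all_boot all_order all_algebra.
From mathcomp Require Import all_classical all_reals all_analysis.
From mathcomp Require Import measurable_realfun ring lra.

Set Implicit Arguments.
Unset Strict Implicit.
Unset Printing Implicit Defensive.

Import Order.TTheory GRing.Theory Num.Theory.
Import numFieldNormedType.Exports.

Local Open Scope classical_set_scope.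
Local Open Scope ring_scope.

(* With [M k := Spi k + P k *m Sx k *m (P k)^T], the closed form of the
   Kullback-Leibler divergence between Gaussians and the second moments of the
   process (the covariance of x_k is [Sx k], that of u_k is [M k]) show that
   J(pol, rho), for [rho k] = N(0, S k), is a constant plus the sum over k of
   KL(N(0, M k) || N(0, S k)). Each term is nonnegative by Gibbs' inequality and
   vanishes only for S k = M k.
   The Gaussian moments come by induction on the dimension: splitting off the top
   coordinate, a Gaussian density is a one-dimensional Gaussian density times the
   density of a Gaussian whose covariance is the Schur complement. *)

(** * One-dimensional Gaussian integrals *)

(** Two moments of x_k suffice because both the control energy and the divergence of N(P x, Spi)
    from N(0, S) become quadratic in x once the control is integrated out; the law of x_k after time
    0 is never identified. The process is known only through probabilities of rectangles in (x_k,
    u_k), so expectations must first be rewritten as iterated integrals against the policy density.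
    This is done for squares of affine forms: nonnegativity makes Tonelli and additivity available
    without integrability conditions, and signed products are recovered by polarization. For
    uniqueness, equality in the pointwise Gibbs bound would give equality of densities almost
    everywhere, from which the covariances would still have to be extracted. Perturbing the
    minimizer of a log-determinant functional stays within matrix algebra. *)

Section ge0_integral_real.
Context d (T : measurableType d) (R : realType)
  (mu : {measure set T -> \bar R}) (D : set T) (mD : measurable D).

Lemma ge0_integral_EFinD (f g : T -> R) :
  measurable_fun setT f -> (forall x, 0 <= f x) ->
  measurable_fun setT g -> (forall x, 0 <= g x) ->
  (\int[mu]_(x in D) (f x + g x)%:E
   = \int[mu]_(x in D) (f x)%:E + \int[mu]_(x in D) (g x)%:E)%E.
Proof.
move=> mf f0 mg g0; under eq_integral do rewrite EFinD.
apply: ge0_integralD => // [x _||x _|]; rewrite ?lee_fin//;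
  exact/measurable_EFinP/measurable_funTS.
Qed.

Lemma ge0_integral_EFinZl (k : R) (f : T -> R) : 0 <= k ->
  measurable_fun setT f -> (forall x, 0 <= f x) ->
  (\int[mu]_(x in D) (k * f x)%:E = k%:E * \int[mu]_(x in D) (f x)%:E)%E.
Proof.
move=> k0 mf f0; under eq_integral do rewrite EFinM.
apply: ge0_integralZl => // [|x _]; rewrite ?lee_fin//;
  exact/measurable_EFinP/measurable_funTS.
Qed.

End ge0_integral_real.

Section one_dim.
Context {R : realType}.
Notation mu := (@lebesgue_measure R).

Let continuous_sqr_gauss_fun : continuous (fun x : R => 2 * x ^+ 2 * gauss_fun x).
Proof.
move=> x; apply: cvgM; last exact: continuous_gauss_fun.
by apply: cvgM; [exact: cvg_cst|exact: exprn_continuous].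
Qed.

Let continuous_expR1B : continuous (fun x : R => expR (1 - x)).
Proof.
move=> x; apply: continuous_comp; last exact: continuous_expR.
by apply: cvgB; [exact: cvg_cst|exact: cvg_id].
Qed.

Let cvg_expR1B : expR (1 - x) @[x --> +oo%R] --> (0 : R).
Proof.
under eq_fun do rewrite expRD.
rewrite -(mulr0 (expR 1)); apply: cvgM; [exact: cvg_cst|exact: cvgr_expR].
Qed.

Let cvg_id_gauss : x * gauss_fun x @[x --> +oo%R] --> (0 : R).
Proof.
(* The upper bound combines [x <= expR x] with [x - x ^+ 2 <= 2 - x]. *)
apply: (@squeeze_cvgr _ _ _ _ (cst 0) (fun x : R => expR (2 - x))).
- near=> x.
  have x0 : 0 <= x by near: x; apply: nbhs_pinfty_ge; exact: num_real.
  rewrite /gauss_fun mulr_ge0 ?expR_ge0//=.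
  apply: (@le_trans _ _ (expR x * expR (- x ^+ 2))).
    rewrite ler_wpM2r ?expR_ge0//.
    by apply: le_trans (expR_ge1Dx x); rewrite lerDr.
  rewrite -expRD ler_expR; nra.
- exact: cvg_cst.
- under eq_fun do rewrite expRD.
  rewrite -(mulr0 (expR 2)); apply: cvgM; [exact: cvg_cst|exact: cvgr_expR].
Unshelve. all: by end_near. Qed.

(* The integrand [(2 x ^+ 2 - 1) * gauss_fun x] has antiderivative
   [- x * gauss_fun x] but changes sign; [expR (1 - x)] dominates [gauss_fun x]
   and makes it nonnegative. *)
Let integral_shifted :
  (\int[mu]_(x in `[0%R, +oo[)
    (2 * x ^+ 2 * gauss_fun x - gauss_fun x + expR (1 - x))%:E = (expR 1)%:E)%E.
Proof.
pose F := fun x : R => - (x * gauss_fun x) - expR (1 - x).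
have dF (x : R) : is_derive x 1 F
    (2 * x ^+ 2 * gauss_fun x - gauss_fun x + expR (1 - x)).
  apply: (@is_derive_eq _ _ _ (- (id * @gauss_fun R) - (fun y => expR (1 - y)))).
  by rewrite /gauss_fun /GRing.scale /=; ring.
rewrite (@ge0_continuous_FTC2y _ _ F _ 0).
- by rewrite -EFinB /F subr0; congr EFin; ring.
- move=> x _; have : gauss_fun x <= expR (1 - x).
    by rewrite /gauss_fun ler_expR; nra.
  have : 0 <= 2 * x ^+ 2 * gauss_fun x.
    by rewrite mulr_ge0 ?gauss_fun_ge0// mulr_ge0// sqr_ge0.
  lra.
- apply: continuous_subspaceT => x; apply: cvgD; last first.
    exact: continuous_expR1B.
  by apply: cvgB; [exact: continuous_sqr_gauss_fun|exact: continuous_gauss_fun].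
- rewrite -(subr0 (0 : R)) -{1}oppr0; apply: cvgB => //; exact: cvgN.
- by move=> x _; exact: ex_derive.
- apply: cvg_at_right_filter.
  by apply: differentiable_continuous; apply/derivable1_diffP; exact: ex_derive.
- by move=> x _; rewrite derive1E derive_val.
Qed.

Let integral_expR1B :
  (\int[mu]_(x in `[0%R, +oo[) (expR (1 - x))%:E = (expR 1)%:E)%E.
Proof.
rewrite (@ge0_continuous_FTC2y _ _ (fun x => - expR (1 - x)) _ 0).
- by rewrite -EFinB subr0; congr EFin; ring.
- by move=> x _; exact: expR_ge0.
- exact: continuous_subspaceT continuous_expR1B.
- by rewrite -oppr0; exact: cvgN.
- by move=> x _; exact: ex_derive.
- by apply: cvg_at_right_filter; apply: cvgN; exact: continuous_expR1B.
- by move=> x _; rewrite derive1E derive_val /GRing.scale /=; ring.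
Qed.

(** Adding [gauss_fun x] to the shifted integrand gives [2 * x ^+ 2 * gauss_fun x + expR (1 - x)].
    Integrated both ways, the shift contributes [expR 1] to each side and cancels, leaving the
    half-line integral of [gauss_fun]. *)
Lemma integral0y_sqr_gauss_fun :
  (\int[mu]_(x in `[0%R, +oo[) (2 * x ^+ 2 * gauss_fun x)%:E
   = (Num.sqrt pi / 2)%:E)%E.
Proof.
have mg : measurable_fun setT (@gauss_fun R) by exact: measurable_gauss_fun.
have mh : measurable_fun setT (fun x : R => 2 * x ^+ 2 * gauss_fun x).
  by apply: measurable_funM => //; exact: measurable_funM.
have me : measurable_fun setT (fun x : R => expR (1 - x)).
  by apply: measurableT_comp => //; exact: measurable_funB.
have h0 (x : R) : (0 <= 2 * x ^+ 2 * gauss_fun x).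
  by rewrite mulr_ge0 ?gauss_fun_ge0// mulr_ge0// sqr_ge0.
have s0 (x : R) : 0 <= 2 * x ^+ 2 * gauss_fun x - gauss_fun x + expR (1 - x).
  have : gauss_fun x <= expR (1 - x) by rewrite /gauss_fun ler_expR; nra.
  by have := h0 x; lra.
have ms : measurable_fun setT (fun x : R =>
    2 * x ^+ 2 * gauss_fun x - gauss_fun x + expR (1 - x)).
  by apply: measurable_funD => //; exact: measurable_funB.
have e0 (x : R) : 0 <= expR (1 - x) by exact: expR_ge0.
have g0 (x : R) : 0 <= gauss_fun x by exact: gauss_fun_ge0.
have addR := ge0_integral_EFinD mu (measurable_itv `[0%R, +oo[) mh h0 me e0.
have addL := ge0_integral_EFinD mu (measurable_itv `[0%R, +oo[) ms s0 mg g0.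
rewrite integral_expR1B in addR.
rewrite integral_shifted integral0y_gauss in addL.
rewrite -[LHS](addeK _ (isT : (expR 1)%:E \is a fin_num)) -addR.
rewrite [X in (X - _)%E](_ : _ = ((expR 1)%:E + (Num.sqrt pi / 2)%:E)%E).
  by rewrite -EFinN -!EFinD; congr EFin; ring.
rewrite -addL; apply: eq_integral => x _.
by congr EFin; ring.
Qed.

Lemma integral_sqr_gauss_fun :
  (\int[mu]_x (x ^+ 2 * gauss_fun x)%:E = (Num.sqrt pi / 2)%:E)%E.
Proof.
rewrite ge0_symfun_integralT//=; first last.
- by move=> x /=; rewrite /gauss_fun !sqrrN.
- move=> x; apply: cvgM; [exact: exprn_continuous|exact: continuous_gauss_fun].
- by move=> x; rewrite mulr_ge0 ?gauss_fun_ge0 ?sqr_ge0.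
rewrite -ge0_integralZl//.
- rewrite -integral0y_sqr_gauss_fun (_ : [set x | _] = `[0, +oo[%classic).
    by apply: eq_integral => x _; rewrite -EFinM mulrA.
  by apply/seteqP; split => x/=; rewrite in_itv/= andbT.
- by rewrite -[X in measurable X]set_itvcy.
- apply/measurable_EFinP/measurable_funTS; apply: measurable_funM => //.
  exact: measurable_gauss_fun.
- by move=> x _; rewrite lee_fin mulr_ge0 ?gauss_fun_ge0 ?sqr_ge0.
Qed.

Lemma ge0_integralN (f : R -> \bar R) :
  measurable_fun setT f -> (forall x, 0 <= f x)%E ->
  (\int[mu]_x f x = \int[mu]_x f (- x)%R)%E.
Proof.
move=> mf f0.
rewrite -(@ge0_integral_pushforward _ _ (measurableTypeR R) (measurableTypeR R)
  R (-%R : measurableTypeR R -> measurableTypeR R) _ mu setT f)//.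
by apply: eq_measure_integral => //= A mA _; exact/esym/lebesgue_measureN.
Qed.

(** The cross term of the square is signed, so the square is not expanded alone: reflecting [x]
    exchanges [b] and [- b], and in the sum of the two integrands the cross terms cancel. Hence the
    detour through twice the integral. *)
Lemma integral_affine_sqr_gauss_fun (a b : R) :
  (\int[mu]_x ((a + b * x) ^+ 2 * gauss_fun x)%:E
   = (Num.sqrt pi * (a ^+ 2 + b ^+ 2 / 2))%:E)%E.
Proof.
have mg : measurable_fun setT (@gauss_fun R) by exact: measurable_gauss_fun.
have mx : measurable_fun setT (fun x : R => x ^+ 2 * gauss_fun x).
  exact: measurable_funM.
pose f (s x : R) := (a + s * x) ^+ 2 * gauss_fun x.
have mf s : measurable_fun setT (f s).
  apply: measurable_funM => //; apply: measurable_funX.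
  by apply: measurable_funD => //; exact: measurable_funM.
have f0 s x : 0 <= f s x by rewrite mulr_ge0 ?sqr_ge0 ?gauss_fun_ge0.
have mEf s : measurable_fun setT (fun x => (f s x)%:E) by exact/measurable_EFinP.
have fN : (\int[mu]_x (f b x)%:E = \int[mu]_x (f (- b) x)%:E)%E.
  rewrite ge0_integralN//; last by move=> x; rewrite lee_fin.
  apply: eq_integral => x _.
  by rewrite /f /gauss_fun !sqrrN mulrN mulNr.
have double : (2%:E * \int[mu]_x (f b x)%:E
    = 2%:E * (Num.sqrt pi * (a ^+ 2 + b ^+ 2 / 2))%:E)%E.
  rewrite mule_natl mule2n {2}fN -ge0_integral_EFinD//; last 2 first.
  - exact: mf.
  - exact: mf.
  transitivity (\int[mu]_x (2 * a ^+ 2 * gauss_fun x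
      + 2 * b ^+ 2 * (x ^+ 2 * gauss_fun x))%:E)%E.
    by apply: eq_integral => x _; congr EFin; rewrite /f; ring.
  have a0 : 0 <= 2 * a ^+ 2 by rewrite mulr_ge0 ?sqr_ge0.
  have b0 : 0 <= 2 * b ^+ 2 by rewrite mulr_ge0 ?sqr_ge0.
  have g0 (x : R) : 0 <= gauss_fun x by exact: gauss_fun_ge0.
  have x0 (x : R) : 0 <= x ^+ 2 * gauss_fun x by rewrite mulr_ge0 ?sqr_ge0.
  rewrite (@ge0_integral_EFinD _ _ _ mu setT _ (fun x => 2 * a ^+ 2 * gauss_fun x)
    (fun x => 2 * b ^+ 2 * (x ^+ 2 * gauss_fun x)))//.
  - rewrite !ge0_integral_EFinZl// integralT_gauss integral_sqr_gauss_fun.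
    by rewrite -!EFinM -EFinD; congr EFin; field.
  - exact: measurable_funM.
  - by move=> x; rewrite mulr_ge0.
  - exact: measurable_funM.
  - by move=> x; rewrite mulr_ge0.
have half (y : \bar R) : (2^-1%:E * (2%:E * y) = y)%E.
  by rewrite muleA -EFinM mulVf// mul1e.
by rewrite -[LHS]half double half.
Qed.

Lemma integral_affine_sqr_normal (c a al be : R) : 0 < a ->
  (\int[mu]_y ((al + be * y) ^+ 2 *
     ((Num.sqrt (2 * pi * a))^-1 * expR (- (2^-1 * ((y - c) ^+ 2 / a)))))%:E
   = ((al + be * c) ^+ 2 + be ^+ 2 * a)%:E)%E.
Proof.
(* With this scale, [y = r * z + c] turns the exponent into [- z ^+ 2], and the normalizing factor
   times the Jacobian [r] into the inverse of [Num.sqrt pi]. *)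
move=> a0; pose r := Num.sqrt (2 * a).
have r0 : 0 < r by rewrite sqrtr_gt0 mulr_gt0.
have r2 : r ^+ 2 = 2 * a by rewrite sqr_sqrtr// mulr_ge0// ltW.
pose F (z : R) : R := r * z + c.
have dF (z : R) : is_derive z 1 F r.
  apply: (@is_derive_eq _ _ _ (r \*: id + cst c)).
  by rewrite /GRing.scale /=; ring.
have F'E : F^`()%classic = cst r.
  by apply/funext => z; rewrite derive1E derive_val.
have FE : F = (fun z => r * (z + c / r)).
  by apply/funext => z; rewrite /F mulrDr mulrCA divff ?mulr1// gt_eqF.
have sE : Num.sqrt (2 * pi * a) = r * Num.sqrt pi.
  by rewrite -mulrA (mulrC pi) mulrA sqrtrM// mulr_ge0// ltW.
have sp0 : 0 < Num.sqrt (pi : R) by rewrite sqrtr_gt0 pi_gt0.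
rewrite (@increasing_ge0_integration_by_substitutionT _ F); first last.
- move=> y; rewrite mulr_ge0 ?sqr_ge0// mulr_ge0 ?expR_ge0.
- move=> y; apply: cvgM.
    apply: (cvg_comp (fun z => al + be * z) (fun z => z ^+ 2)).
      apply: cvgD; first exact: cvg_cst.
      by apply: cvgM; [exact: cvg_cst|exact: cvg_id].
    exact: exprn_continuous.
  apply: cvgM; first exact: cvg_cst.
  apply: (cvg_comp _ expR); last exact: continuous_expR.
  apply: cvgN; apply: cvgM; first exact: cvg_cst.
  apply: cvgM; last exact: cvg_cst.
  apply: (cvg_comp (fun z => z - c) (fun z => z ^+ 2)).
    by apply: cvgB; [exact: cvg_id|exact: cvg_cst].
  exact: exprn_continuous.
- by rewrite FE; apply: gt0_cvgMry => //; exact: cvg_addrr.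
- by rewrite FE; apply: gt0_cvgMrNy => //; exact: cvg_addrr_Ny.
- by move=> z; exact: ex_derive.
- by rewrite F'E; exact: is_cvg_cst.
- by rewrite F'E; exact: is_cvg_cst.
- by rewrite F'E => ?; exact: cvg_cst.
- by move=> x y xy; rewrite /F ltrD2r ltr_pM2l.
transitivity (\int[mu]_z ((Num.sqrt pi)^-1 *
   (((al + be * c) + be * r * z) ^+ 2 * gauss_fun z))%:E)%E.
  apply: eq_integral => z _; rewrite F'E; congr EFin.
  transitivity ((al + be * F z) ^+ 2 * ((Num.sqrt (2 * pi * a))^-1
    * expR (- (2^-1 * ((F z - c) ^+ 2 / a)))) * r) => //.
  rewrite sE /F addrK (_ : 2^-1 * _ = z ^+ 2); last first.
    by rewrite exprMn r2; field; exact/lt0r_neq0.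
  by rewrite /gauss_fun; field; rewrite !lt0r_neq0.
rewrite ge0_integral_EFinZl//.
- rewrite integral_affine_sqr_gauss_fun -EFinM; congr EFin.
  by rewrite exprMn r2; field; apply/lt0r_neq0.
- apply: measurable_funM; last exact: measurable_gauss_fun.
  apply: measurable_funX; apply: measurable_funD => //.
- by move=> z; rewrite mulr_ge0 ?sqr_ge0 ?gauss_fun_ge0.
Qed.

End one_dim.

(** * Schur complements of positive definite matrices *)

Section schur.
Context {R : realType}.

Definition schur n (S : 'M[R]_(1 + n)) : 'M[R]_n :=
  drsubmx S - (S 0 0)^-1 *: (dlsubmx S *m (dlsubmx S)^T).

Let elim_mx n (c : 'cV[R]_n) : 'M[R]_(1 + n) := block_mx 1%:M 0 c 1%:M.

Let elim_mxK n (c : 'cV[R]_n) : elim_mx c *m elim_mx (- c) = 1%:M.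
Proof.
rewrite mulmx_block !mul1mx !mulmx1 !mul0mx !mulmx0 !addr0 add0r subrr.
by rewrite -scalar_mx_block.
Qed.

Let elim_mxNK n (c : 'cV[R]_n) : elim_mx (- c) *m elim_mx c = 1%:M.
Proof. by have := elim_mxK (- c); rewrite opprK. Qed.

Let det_elim_mx n (c : 'cV[R]_n) : \det (elim_mx c) = 1.
Proof. by rewrite det_lblock !det1 mul1r. Qed.

Let schur_diag n (S : 'M[R]_(1 + n)) : 'M[R]_(1 + n) :=
  block_mx (S 0 0)%:M 0 0 (schur S).

(** Block LDL^T factorization, eliminating the column below the pivot. The determinant, the inverse
    and the quadratic form of [S] are all read off from it. *)
Let schur_decomp n (S : 'M[R]_(1 + n)) : S^T = S -> S 0 0 != 0 ->
  S = elim_mx ((S 0 0)^-1 *: dlsubmx S) *m schur_diag S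
      *m (elim_mx ((S 0 0)^-1 *: dlsubmx S))^T.
Proof.
move=> symS a0.
have ulE : ulsubmx S = (S 0 0)%:M.
  by rewrite [LHS]mx11_scalar !mxE; congr (S _ _)%:M; exact: val_inj.
have urE : ursubmx S = (dlsubmx S)^T by rewrite trmx_dlsub symS.
rewrite tr_block_mx !mulmx_block !trmx1 !trmx0.
rewrite !(mul1mx, mulmx1, mul0mx, mulmx0, addr0, add0r).
rewrite -[LHS]submxK urE ulE /schur; congr block_mx.
- by rewrite linearZ/= mul_scalar_mx scalerA divff// scale1r.
- by rewrite mul_mx_scalar scalerA divff// scale1r.
- rewrite mul_mx_scalar scalerA divff// scale1r linearZ/= -scalemxAr.
  by rewrite addrC subrK.
Qed.

Lemma posdef_ge0 n (S : 'M[R]_n) (v : 'cV[R]_n) : posdef S ->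
  0 <= (v^T *m S *m v) 0 0.
Proof.
move=> [_ S_gt0].
by have [->|/S_gt0/ltW//] := eqVneq v 0; rewrite mulmx0 mxE.
Qed.

Lemma posdef_pivot_gt0 n (S : 'M[R]_(1 + n)) : posdef S -> 0 < S 0 0.
Proof.
move=> [_ /(_ (delta_mx 0 0))].
rewrite trmx_delta -rowE mxE (bigD1 0)//= big1 ?addr0; last first.
  by move=> i /negPf i0; rewrite !mxE i0 mulr0.
rewrite !mxE eqxx mulr1; apply.
by apply/eqP => /matrixP/(_ 0 0)/eqP; rewrite !mxE eqxx oner_eq0.
Qed.

Lemma posdef_schur n (S : 'M[R]_(1 + n)) : posdef S -> posdef (schur S).
Proof.
move=> pS; have [symS posS] := pS; have a0 := lt0r_neq0 (posdef_pivot_gt0 pS).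
split.
  by rewrite /schur linearB linearZ/= trmx_mul trmxK trmx_drsub symS.
move=> w w0.
(* The transposed elimination matrix of [S] sends [v] to [col_mx 0 w], so the pivot drops out and
   the form of [S] at [v] is that of [schur S] at [w]. *)
pose v : 'cV[R]_(1 + n) :=
  (elim_mx (- ((S 0 0)^-1 *: dlsubmx S)))^T *m col_mx 0 w.
have vE : v = col_mx ((- ((S 0 0)^-1 *: dlsubmx S))^T *m w) w.
  rewrite /v tr_block_mx mul_block_col !trmx1 !trmx0.
  by rewrite !(mul1mx, mulmx0, add0r).
have v0 : v != 0.
  apply: contra_neq w0 => v0.
  by rewrite -[w](col_mxKd ((- ((S 0 0)^-1 *: dlsubmx S))^T *m w)) -vE v0 linear0.
have := posS _ v0.
rewrite {1}(schur_decomp symS a0) /v trmx_mul trmxK -!mulmxA.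
rewrite (mulmxA (elim_mx _)^T (elim_mx _)^T) -trmx_mul.
rewrite elim_mxNK trmx1 mul1mx.
rewrite (mulmxA (elim_mx _) (elim_mx _)) elim_mxNK mul1mx.
rewrite tr_col_mx mul_block_col mul_row_col !trmx0.
by rewrite !(mul0mx, mulmx0, add0r) mulmxA.
Qed.

Lemma det_schur n (S : 'M[R]_(1 + n)) : posdef S ->
  \det S = S 0 0 * \det (schur S).
Proof.
move=> pS; have a0 := lt0r_neq0 (posdef_pivot_gt0 pS).
rewrite {1}(schur_decomp pS.1 a0) !det_mulmx det_tr det_elim_mx mul1r mulr1.
by rewrite det_ublock det_scalar expr1.
Qed.

Lemma posdef_det_gt0 n (S : 'M[R]_n) : posdef S -> 0 < \det S.
Proof.
elim: n S => [S _|n IHn S pS]; first by rewrite det_mx00.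
rewrite (det_schur pS) mulr_gt0//; first exact: posdef_pivot_gt0.
exact/IHn/posdef_schur.
Qed.

Lemma posdef_unit n (S : 'M[R]_n) : posdef S -> S \in unitmx.
Proof. by move=> /posdef_det_gt0/lt0r_neq0; rewrite unitmxE unitfE. Qed.

Lemma invmx_uniq n (S X : 'M[R]_n) : S *m X = 1%:M -> invmx S = X.
Proof.
by move=> SX; have [uS _] := mulmx1_unit SX; rewrite -[LHS]mulmx1 -SX mulKmx.
Qed.

(** Variance decomposition: for a Gaussian vector of covariance [S], the first summand is the
    variance of the linear form [w] explained by the top coordinate, the second its conditional
    variance given that coordinate. *)
Lemma quad_schur n (S : 'M[R]_(1 + n)) (w : 'cV[R]_(1 + n)) :
  S^T = S -> S 0 0 != 0 ->
  (w^T *m S *m w) 0 0 =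
  (w 0 0 + (S 0 0)^-1 * ((dlsubmx S)^T *m dsubmx w) 0 0) ^+ 2 * S 0 0
  + ((dsubmx w)^T *m schur S *m dsubmx w) 0 0.
Proof.
move=> symS a0; set b := dlsubmx S; set a := S 0 0.
have u0 : usubmx w = (w 0 0)%:M.
  by rewrite [LHS]mx11_scalar !mxE; congr (w _ _)%:M; exact: val_inj.
rewrite {1}(schur_decomp symS a0).
set E := elim_mx _; rewrite !mulmxA.
have -> : w^T *m E = (E^T *m w)^T by rewrite trmx_mul trmxK.
rewrite -mulmxA.
have -> : E^T *m w
    = col_mx ((w 0 0 + a^-1 * (b^T *m dsubmx w) 0 0)%:M) (dsubmx w).
  rewrite -{1}[w]vsubmxK /E tr_block_mx mul_block_col !trmx1 !trmx0.
  rewrite !(mul1mx, mul0mx, add0r) u0; congr col_mx.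
  rewrite linearZ/= -scalemxAl raddfD/=.
  by rewrite -scale_scalar_mx -mx11_scalar.
rewrite tr_col_mx mul_row_block mul_row_col !(mulmx0, addr0, add0r).
rewrite tr_scalar_mx -!scalar_mxM [LHS]mxE; congr (_ + _).
by rewrite mxE eqxx mulr1n mulrAC -expr2.
Qed.

(** Inverse elimination maps [w] to its top entry and [r], the residual of the lower entries after
    regression on the top one; in these coordinates the inverse of [S] is block diagonal. *)
Lemma quad_invmx_schur n (S : 'M[R]_(1 + n)) (w : 'cV[R]_(1 + n)) :
  posdef S ->
  let r := dsubmx w - ((w 0 0) / S 0 0) *: dlsubmx S in
  (w^T *m invmx S *m w) 0 0 =
  (w 0 0) ^+ 2 / S 0 0 + (r^T *m invmx (schur S) *m r) 0 0.
Proof.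
move=> pS r; have [symS _] := pS.
have a0 := lt0r_neq0 (posdef_pivot_gt0 pS).
have uS := posdef_unit (posdef_schur pS).
set a := S 0 0 in a0 r *; set b := dlsubmx S in r *.
have u0 : usubmx w = (w 0 0)%:M.
  by rewrite [LHS]mx11_scalar !mxE; congr (w _ _)%:M; exact: val_inj.
set c := a^-1 *: b.
have -> : invmx S = (elim_mx (- c))^T *m
    block_mx (a^-1)%:M 0 0 (invmx (schur S)) *m elim_mx (- c).
  apply: invmx_uniq; rewrite {1}(schur_decomp symS a0) -/a -/b -/c.
  rewrite -!mulmxA (mulmxA (elim_mx c)^T) -trmx_mul.
  rewrite elim_mxNK trmx1 mul1mx (mulmxA (schur_diag S)) mulmx_block.
  rewrite !(mulmx0, mul0mx, addr0, add0r) mulmxV// -scalar_mxM divff//.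
  by rewrite -scalar_mx_block mul1mx elim_mxK.
have -> : w^T *m ((elim_mx (- c))^T *m block_mx (a^-1)%:M 0 0 (invmx (schur S))
    *m elim_mx (- c)) *m w = (elim_mx (- c) *m w)^T
    *m block_mx (a^-1)%:M 0 0 (invmx (schur S)) *m (elim_mx (- c) *m w).
  by rewrite trmx_mul !mulmxA.
have -> : elim_mx (- c) *m w = col_mx (w 0 0)%:M r.
  rewrite -{1}[w]vsubmxK mul_block_col !(mul1mx, mul0mx, addr0) u0.
  by rewrite mul_mx_scalar scalerN scalerA addrC.
rewrite tr_col_mx mul_row_block mul_row_col !(mulmx0, addr0, add0r).
rewrite tr_scalar_mx -!scalar_mxM [LHS]mxE; congr (_ + _).
by rewrite mxE eqxx mulr1n mulrAC -expr2.
Qed.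

Lemma gauss_vcons n (mu : 'cV[R]_n.+1) (S : 'M[R]_(1 + n)) (y : R)
    (v : 'cV[R]_n) : posdef S ->
  gauss mu S (vcons (y, v)) =
  (Num.sqrt (2 * pi * S 0 0))^-1 * expR (- (2^-1 * ((y - mu 0 0) ^+ 2 / S 0 0)))
  * gauss (dsubmx (mu : 'cV_(1 + n)) + ((y - mu 0 0) / S 0 0) *: dlsubmx S)
      (schur S) v.
Proof.
move=> pS; have a0 := posdef_pivot_gt0 pS.
rewrite /gauss (quad_invmx_schur _ pS) (det_schur pS).
have -> : (vcons (y, v) - mu) 0 0 = y - mu 0 0.
  rewrite mxE; congr (_ + _); last by rewrite mxE.
  by rewrite /vcons mxE; case: splitP => // j _; rewrite ord1 mxE eqxx.
have -> : @dsubmx R 1 n 1 (vcons (y, v) - mu) = v - @dsubmx R 1 n 1 mu.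
  rewrite -[v in RHS](@col_mxKd R 1 n 1 (y%:M)) -[RHS]linearB.
  by congr dsubmx.
set r := v - _ - _.
rewrite -[v - (_ + _)](_ : r = _); last by rewrite /r opprD addrA.
have expE (p q : R) : expR (- (2^-1 * (p + q)))
    = expR (- (2^-1 * p)) * expR (- (2^-1 * q)).
  by rewrite -expRD; congr expR; ring.
have -> : (2 * pi) ^+ n.+1 * (S 0 0 * \det (schur S))
    = (2 * pi * S 0 0) * ((2 * pi) ^+ n * \det (schur S)).
  by rewrite exprS; ring.
rewrite expE sqrtrM ?invfM; first by rewrite mulrACA.
by rewrite mulr_ge0 ?(ltW a0)// mulr_ge0// pi_ge0.
Qed.

End schur.

(** * Moments of Gaussian densities on column vectors *)

Section measurable_mx_theory.
Context d (X : measurableType d) (R : realType).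

Lemma measurable_mx_entry p q (f : X -> 'M[R]_(p, q)) i j :
  measurable_fun setT f -> measurable_fun setT (fun x => f x i j : R).
Proof. by move/measurable_fun_mxP; exact. Qed.

Lemma measurable_mxD p q (f g : X -> 'M[R]_(p, q)) :
  measurable_fun setT f -> measurable_fun setT g ->
  measurable_fun setT (fun x => f x + g x).
Proof.
move=> mf mg; apply/measurable_fun_mxP => i j.
under eq_fun do rewrite mxE.
by apply: measurable_funD; exact: measurable_mx_entry.
Qed.

Lemma measurable_mxN p q (f : X -> 'M[R]_(p, q)) :
  measurable_fun setT f -> measurable_fun setT (fun x => - f x).
Proof.
move=> mf; apply/measurable_fun_mxP => i j.
under eq_fun do rewrite mxE.
by apply: measurable_funN; exact: measurable_mx_entry.
Qed.

Lemma measurable_mxM p q r (f : X -> 'M[R]_(p, q)) (g : X -> 'M[R]_(q, r)) :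
  measurable_fun setT f -> measurable_fun setT g ->
  measurable_fun setT (fun x => f x *m g x).
Proof.
move=> mf mg; apply/measurable_fun_mxP => i j.
under eq_fun do rewrite mxE.
apply: measurable_sum => k.
by apply: measurable_funM; exact: measurable_mx_entry.
Qed.

Lemma measurable_trmx p q (f : X -> 'M[R]_(p, q)) :
  measurable_fun setT f -> measurable_fun setT (fun x => (f x)^T).
Proof.
move=> mf; apply/measurable_fun_mxP => i j.
by under eq_fun do rewrite mxE; exact: measurable_mx_entry.
Qed.

Lemma measurable_affine n (al : R) (be : 'cV[R]_n) (f : X -> 'cV[R]_n) :
  measurable_fun setT f ->
  measurable_fun setT (fun x => al + (be^T *m f x) 0 0 : R).
Proof.
move=> mf; apply: measurable_funD => //.
by apply: measurable_mx_entry; exact: measurable_mxM.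
Qed.

Lemma measurable_quad n (S : 'M[R]_n) (f g : X -> 'cV[R]_n) :
  measurable_fun setT f -> measurable_fun setT g ->
  measurable_fun setT (fun x => ((f x)^T *m S *m g x) 0 0 : R).
Proof.
move=> mf mg; apply: measurable_mx_entry; apply: measurable_mxM => //.
by apply: measurable_mxM => //; exact: measurable_trmx.
Qed.

Lemma measurable_gauss n (S : 'M[R]_n) (f g : X -> 'cV[R]_n) :
  measurable_fun setT f -> measurable_fun setT g ->
  measurable_fun setT (fun x => gauss (f x) S (g x) : R).
Proof.
move=> mf mg; apply: measurable_funM => //.
apply: measurableT_comp => //; apply: measurable_funN.
apply: measurable_funM => //.
by apply: measurable_quad; apply: measurable_mxD => //; exact: measurable_mxN.
Qed.

End measurable_mx_theory.

Section gaussian_moments.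
Context {R : realType}.

Lemma gauss_ge0 n (mu : 'cV[R]_n) (S : 'M[R]_n) v : 0 <= gauss mu S v.
Proof. by rewrite mulr_ge0 ?expR_ge0// invr_ge0 sqrtr_ge0. Qed.

Lemma gauss_gt0 n (mu : 'cV[R]_n) (S : 'M[R]_n) v : posdef S ->
  0 < gauss mu S v.
Proof.
move=> pS; rewrite mulr_gt0 ?expR_gt0// invr_gt0 sqrtr_gt0.
by rewrite mulr_gt0 ?posdef_det_gt0// exprn_gt0// mulr_gt0// pi_gt0.
Qed.

Lemma vcons_eta n (v : 'cV[R]_n.+1) :
  v = vcons (v 0 0, dsubmx (v : 'cV_(1 + n))).
Proof.
rewrite -[LHS](@vsubmxK R 1 n 1) [usubmx _]mx11_scalar mxE.
by rewrite (_ : lshift n 0 = 0)//; exact: val_inj.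
Qed.

Lemma dot_vcons n (be : 'cV[R]_n.+1) (y : R) (v : 'cV[R]_n) :
  (be^T *m vcons (y, v)) 0 0
  = be 0 0 * y + ((dsubmx (be : 'cV_(1 + n)))^T *m v) 0 0.
Proof.
transitivity (((col_mx (be 0 0)%:M (@dsubmx R 1 n 1 be))^T
  *m col_mx y%:M v) 0 0); first by rewrite -[col_mx (be 0 0)%:M _]vcons_eta.
rewrite tr_col_mx mul_row_col mxE; congr (_ + _).
by rewrite tr_scalar_mx -scalar_mxM mxE eqxx.
Qed.

Lemma integral_lebesgue_cVS n (f : 'cV[R]_n.+1 -> R) :
  measurable_fun setT f -> (forall v, 0 <= f v) ->
  (\int[lebesgue_cV]_v (f v)%:E = \int[@lebesgue_measure R]_y
     \int[lebesgue_cV]_v (f (@vcons R n (y, v)))%:E)%E.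
Proof.
move=> mf f0.
rewrite [LHS](ge0_integral_pushforward (@measurable_vcons R n))//.
- rewrite fubini_tonelli1//=.
    by apply: measurableT_comp; [exact/measurable_EFinP|exact: measurable_vcons].
  by move=> x; rewrite lee_fin.
- exact/measurable_EFinP.
- by move=> x _; rewrite lee_fin.
Qed.

(** The induction needs arbitrary means and affine forms: once the top coordinate [y] is fixed, the
    inner integral has a conditional mean and a constant term that depend on [y]. Its value is again
    the square of an affine function of [y] plus a constant, which the one-dimensional formula
    integrates. *)
Theorem integral_affine_sqr_gauss n (mu : 'cV[R]_n) (S : 'M[R]_n)
    (al : R) (be : 'cV[R]_n) : posdef S ->
  (\int[lebesgue_cV]_v ((al + (be^T *m v) 0 0) ^+ 2 * gauss mu S v)%:E
   = ((al + (be^T *m mu) 0 0) ^+ 2 + (be^T *m S *m be) 0 0)%:E)%E.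
Proof.
elim: n mu S al be => [|n IHn] mu S al be pS.
  rewrite integral_dirac//=; last first.
    apply/measurable_EFinP; apply: measurable_funM.
      by apply: measurable_funX; exact: measurable_affine.
    exact: measurable_gauss.
  rewrite diracT mul1e; congr EFin.
  rewrite !mxE !big_ord0 !addr0 /gauss !mxE !big_ord0.
  by rewrite det_mx00 expr0 mulr1 sqrtr1 invr1 mulr0 oppr0 expR0 !mulr1.
have pSc := @posdef_schur _ n _ pS.
have a0 := @posdef_pivot_gt0 _ n _ pS.
pose a : R := S 0 0.
pose b : 'cV[R]_n := @dlsubmx R 1 n 1 n S.
pose bed : 'cV[R]_n := @dsubmx R 1 n 1 be.
pose mud : 'cV[R]_n := @dsubmx R 1 n 1 mu.
(* Given the top coordinate [y], the form [bed] has a conditional mean of slope [k] in [y] and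
   conditional variance [q]. *)
pose k := (bed^T *m b) 0 0 / a.
pose q := (bed^T *m schur S *m bed) 0 0.
have q0 : 0 <= q.
  exact: posdef_ge0.
pose g (y : R) := (Num.sqrt (2 * pi * a))^-1
  * expR (- (2^-1 * ((y - mu 0 0) ^+ 2 / a))).
have g0 y : 0 <= g y by rewrite mulr_ge0 ?expR_ge0// invr_ge0 sqrtr_ge0.
rewrite integral_lebesgue_cVS; last 2 first.
- apply: measurable_funM.
    by apply: measurable_funX; exact: measurable_affine.
  exact: measurable_gauss.
- by move=> v; rewrite mulr_ge0 ?gauss_ge0 ?sqr_ge0.
transitivity (\int[@lebesgue_measure R]_y
  (((al + (bed^T *m mud) 0 0 - k * mu 0 0) + (be 0 0 + k) * y) ^+ 2 * g y
    + q * g y)%:E)%E.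
  apply: eq_integral => y _.
  pose m : 'cV[R]_n := mud + ((y - mu 0 0) / a) *: b.
  transitivity (\int[lebesgue_cV]_v (g y * (((al + be 0 0 * y)
      + (bed^T *m v) 0 0) ^+ 2 * gauss m (schur S) v))%:E)%E.
    apply: eq_integral => v _; congr EFin.
    by rewrite dot_vcons gauss_vcons// addrA mulrCA.
  rewrite ge0_integral_EFinZl//; last 2 first.
  - apply: measurable_funM.
      by apply: measurable_funX; exact: measurable_affine.
    exact: measurable_gauss.
  - by move=> v; rewrite mulr_ge0 ?gauss_ge0 ?sqr_ge0.
  rewrite IHn// -EFinM; congr EFin; rewrite -/q.
  have -> : (bed^T *m m) 0 0 = (bed^T *m mud) 0 0 + (y - mu 0 0) * k.
    by rewrite /m mulmxDr -scalemxAr mxE [X in _ + X]mxE /k; ring.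
  by ring.
have mg : measurable_fun setT g.
  apply: measurable_funM => //; apply: measurableT_comp => //.
  apply: measurable_funN; apply: measurable_funM => //.
  apply: measurable_funM => //; apply: measurable_funX.
  exact: measurable_funB.
have mh : measurable_fun setT (fun y : R => ((al + (bed^T *m mud) 0 0
    - k * mu 0 0) + (be 0 0 + k) * y) ^+ 2 * g y).
  apply: measurable_funM => //; apply: measurable_funX.
  by apply: measurable_funD => //; exact: measurable_funM.
have integral_g : (\int[@lebesgue_measure R]_y (g y)%:E = 1)%E.
  have := integral_affine_sqr_normal (mu 0 0) 1 0 a0.
  rewrite mul0r addr0 expr1n expr0n/= mul0r addr0 => <-.
  by apply: eq_integral => y _; congr EFin; rewrite mul0r addr0 expr1n mul1r.
rewrite ge0_integral_EFinD//; last 3 first.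
- by move=> y; rewrite mulr_ge0 ?sqr_ge0.
- exact: measurable_funM.
- by move=> y; rewrite mulr_ge0.
rewrite ge0_integral_EFinZl// integral_g mule1.
rewrite integral_affine_sqr_normal// -EFinD; congr EFin.
rewrite [in RHS](vcons_eta mu) dot_vcons -/mud -/bed.
rewrite (@quad_schur _ n S be pS.1 (lt0r_neq0 a0)) -/bed -/q -/a.
have -> : a^-1 * ((@dlsubmx R 1 n 1 n S)^T *m @dsubmx R 1 n 1 be) 0 0 = k.
  rewrite /k mulrC -[in RHS](trmxK b) -trmx_mul [in RHS]mxE.
  by congr (_ / _).
ring.
Qed.
End gaussian_moments.

(** * Integrals of quadratic forms *)

Section has_integral.
Context d (T : measurableType d) (R : realType)
  (mu : {measure set T -> \bar R}).
Implicit Types (f g : T -> R) (r s : R).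

(** Integrability travels with the value, so that signed integrands can be added, scaled and
    subtracted without separate side conditions. *)
Definition has_integral f r : Prop :=
  mu.-integrable setT (EFin \o f) /\ (\int[mu]_x (f x)%:E = r%:E)%E.

Lemma eq_has_integral f g r : f =1 g -> has_integral f r -> has_integral g r.
Proof. by move=> /funext ->. Qed.

Lemma ge0_has_integral f r : measurable_fun setT f -> (forall x, 0 <= f x) ->
  (\int[mu]_x (f x)%:E = r%:E)%E -> has_integral f r.
Proof.
move=> mf f0 fr; split => //; apply/integrableP; split.
  exact/measurable_EFinP.
under eq_integral do rewrite /= ger0_norm//.
by rewrite fr ltry.
Qed.

Lemma has_integralD f g r s : has_integral f r -> has_integral g s ->
  has_integral (fun x => f x + g x) (r + s).
Proof.
move=> [If fr] [Ig gs]; split.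
  exact: integrableD If Ig.
by under eq_integral do rewrite EFinD; rewrite integralD// fr gs.
Qed.

Lemma has_integralZ k f r : has_integral f r ->
  has_integral (fun x => k * f x) (k * r).
Proof.
move=> [If fr]; split.
  exact: (integrableZl measurableT k If).
by under eq_integral do rewrite EFinM; rewrite integralZl// fr.
Qed.

Lemma has_integralB f g r s : has_integral f r -> has_integral g s ->
  has_integral (fun x => f x - g x) (r - s).
Proof.
move=> fr /(has_integralZ (-1))/(has_integralD fr).
by rewrite mulN1r; apply: eq_has_integral => x; rewrite mulN1r.
Qed.

Lemma has_integral0 : has_integral (fun=> 0) 0.
Proof.
split; last by rewrite integral0.
exact: integrable0.
Qed.

Lemma has_integral_sum I (rg : seq I) (F : I -> T -> R) (r : I -> R) :
  (forall i, has_integral (F i) (r i)) ->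
  has_integral (fun x => \sum_(i <- rg) F i x) (\sum_(i <- rg) r i).
Proof.
move=> Fr; elim: rg => [|i rg IH].
  rewrite big_nil; apply: eq_has_integral has_integral0 => x.
  by rewrite big_nil.
rewrite big_cons; apply: eq_has_integral (has_integralD (Fr i) IH) => x.
by rewrite big_cons.
Qed.

Lemma le_has_integral f g r s : (forall x, f x <= g x) ->
  has_integral f r -> has_integral g s -> r <= s.
Proof.
move=> fg [If fr] [Ig gs]; rewrite -lee_fin -fr -gs.
by apply: le_integral => // x _; rewrite /= lee_fin.
Qed.

End has_integral.

Section second_moments.
Context d (T : measurableType d) (R : realType)
  (mu : {measure set T -> \bar R}) (n : nat).
Variables (g : T -> R) (Z : T -> 'cV[R]_n) (m : 'cV[R]_n) (S : 'M[R]_n).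

(* The law of [Z] under the measure of density [g] has mass one, mean [m] and
   covariance [S]; using squares only keeps every integrand nonnegative. *)
Definition second_moments : Prop := forall (al : R) (be : 'cV[R]_n),
  (\int[mu]_x ((al + (be^T *m Z x) 0 0) ^+ 2 * g x)%:E
   = ((al + (be^T *m m) 0 0) ^+ 2 + (be^T *m S *m be) 0 0)%:E)%E.

Hypotheses (mg : measurable_fun setT g) (g0 : forall x, 0 <= g x)
  (mZ : measurable_fun setT Z) (ZmS : second_moments).

Let has_integral_sqr (al : R) (be : 'cV[R]_n) :
  has_integral mu (fun x => (al + (be^T *m Z x) 0 0) ^+ 2 * g x)
    ((al + (be^T *m m) 0 0) ^+ 2 + (be^T *m S *m be) 0 0).
Proof.
apply: ge0_has_integral => //.
  apply: measurable_funM => //; apply: measurable_funX.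
  exact: measurable_affine.
by move=> x; rewrite mulr_ge0 ?sqr_ge0.
Qed.

Lemma second_moments_mass : has_integral mu g 1.
Proof.
have := has_integral_sqr 1 0.
rewrite trmx0 !mul0mx !mxE !addr0 expr1n.
by apply: eq_has_integral => x; rewrite mul0mx mxE addr0 expr1n mul1r.
Qed.

(** Polarization: the product is a quarter of the difference of the squares of the sum and of the
    difference of the two affine forms. *)
Lemma second_moments_prod (al : R) (be : 'cV[R]_n) (al' : R) (be' : 'cV[R]_n) :
  S^T = S ->
  has_integral mu
    (fun x => (al + (be^T *m Z x) 0 0) * (al' + (be'^T *m Z x) 0 0) * g x)
    ((al + (be^T *m m) 0 0) * (al' + (be'^T *m m) 0 0)
     + (be^T *m S *m be') 0 0).
Proof.
move=> symS.
have dotD (z : 'cV[R]_n) :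
    ((be + be')^T *m z) 0 0 = (be^T *m z) 0 0 + (be'^T *m z) 0 0.
  by rewrite linearD mulmxDl mxE.
have dotB (z : 'cV[R]_n) :
    ((be - be')^T *m z) 0 0 = (be^T *m z) 0 0 - (be'^T *m z) 0 0.
  by rewrite linearB mulmxBl mxE [X in _ + X]mxE.
have symb : (be'^T *m S *m be) 0 0 = (be^T *m S *m be') 0 0.
  transitivity ((be'^T *m S *m be)^T 0 0); first by rewrite [RHS]mxE.
  by rewrite !trmx_mul trmxK symS mulmxA.
have quadD : ((be + be')^T *m S *m (be + be')) 0 0 = (be^T *m S *m be) 0 0
    + 2 * (be^T *m S *m be') 0 0 + (be'^T *m S *m be') 0 0.
  rewrite -mulmxA dotD !mulmxA !mulmxDr mxE [X in _ + X]mxE symb; ring.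
have quadB : ((be - be')^T *m S *m (be - be')) 0 0 = (be^T *m S *m be) 0 0
    - 2 * (be^T *m S *m be') 0 0 + (be'^T *m S *m be') 0 0.
  have mxB (M N : 'M[R]_1) : (M - N) 0 0 = M 0 0 - N 0 0 by rewrite !mxE.
  by rewrite -mulmxA dotB !mulmxA !mulmxBr !mxB symb; ring.
have := has_integralZ 4^-1 (has_integralB (has_integral_sqr (al + al') (be + be'))
  (has_integral_sqr (al - al') (be - be'))).
rewrite !dotD !dotB quadD quadB => H.
rewrite [X in has_integral _ _ X](_ : _ = 4^-1 * ((al + al' +
  ((be^T *m m) 0 0 + (be'^T *m m) 0 0)) ^+ 2 + ((be^T *m S *m be) 0 0 +
  2 * (be^T *m S *m be') 0 0 + (be'^T *m S *m be') 0 0) - ((al - al' +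
  ((be^T *m m) 0 0 - (be'^T *m m) 0 0)) ^+ 2 + ((be^T *m S *m be) 0 0 -
  2 * (be^T *m S *m be') 0 0 + (be'^T *m S *m be') 0 0)))); last by field.
by apply: eq_has_integral H => x; rewrite dotD dotB; field.
Qed.

(** Each coordinate of [Z x - c] is an affine form with coefficient vector [delta_mx i 0], so the
    double sum defining the quadratic form is integrated term by term; symmetry of [S] turns the
    covariance terms into the trace. *)
Lemma second_moments_quad (Q : 'M[R]_n) (c : 'cV[R]_n) : S^T = S ->
  has_integral mu (fun x => ((Z x - c)^T *m Q *m (Z x - c)) 0 0 * g x)
    (((m - c)^T *m Q *m (m - c)) 0 0 + \tr (Q *m S)).
Proof.
move=> symS.
have quadE (z : 'cV[R]_n) : (z^T *m Q *m z) 0 0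
    = \sum_i \sum_j Q i j * (z i 0 * z j 0).
  rewrite mxE exchange_big/=; apply: eq_bigr => j _.
  rewrite mxE mulr_suml; apply: eq_bigr => i _.
  by rewrite !mxE; ring.
have entryE (z : 'cV[R]_n) i : - c i 0 + ((delta_mx i 0 : 'cV[R]_n)^T *m z) 0 0
    = (z - c) i 0.
  by rewrite trmx_delta -rowE !mxE addrC.
have ij i j := has_integralZ (Q i j)
  (second_moments_prod (- c i 0) (delta_mx i 0) (- c j 0) (delta_mx j 0) symS).
have := has_integral_sum (index_enum _) (fun i =>
  has_integral_sum (index_enum _) (ij i)).
move=> H.
rewrite [X in has_integral _ _ X](_ : _ = \sum_i \sum_j Q i j *
  ((- c i 0 + ((delta_mx i 0 : 'cV[R]_n)^T *m m) 0 0)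
   * (- c j 0 + ((delta_mx j 0 : 'cV[R]_n)^T *m m) 0 0)
   + ((delta_mx i 0 : 'cV[R]_n)^T *m S *m (delta_mx j 0 : 'cV[R]_n)) 0 0)).
  apply: eq_has_integral H => x; rewrite quadE mulr_suml.
  apply: eq_bigr => i _; rewrite mulr_suml; apply: eq_bigr => j _.
  by rewrite !entryE mulrA.
rewrite quadE /mxtrace -big_split; apply: eq_bigr => i _.
rewrite [(Q *m S) i i]mxE -big_split; apply: eq_bigr => j _ /=.
rewrite !entryE mulrDr; congr (_ + _ * _).
by rewrite trmx_delta -rowE -colE !mxE -[in LHS]symS mxE.
Qed.

End second_moments.

(** * Kullback-Leibler divergence of Gaussians *)

Section gaussian_KL.
Context {R : realType} {m : nat}.
Implicit Types (mu v : 'cV[R]_m) (S M : 'M[R]_m).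

Definition gauss_KL mu S1 S2 : R :=
  2^-1 * (ln (\det S2) - ln (\det S1) + (mu^T *m invmx S2 *m mu) 0 0
          + \tr (invmx S2 *m S1) - m%:R).

Lemma ln_gauss mu S v : posdef S ->
  ln (gauss mu S v) = - (2^-1 * (ln ((2 * pi) ^+ m) + ln (\det S)))
    - 2^-1 * ((v - mu)^T *m invmx S *m (v - mu)) 0 0.
Proof.
move=> pS; have d0 := posdef_det_gt0 pS.
have p0 : 0 < (2 * pi : R) ^+ m by rewrite exprn_gt0// mulr_gt0// pi_gt0.
rewrite lnM ?posrE ?expR_gt0 ?invr_gt0 ?sqrtr_gt0 ?mulr_gt0// expRK.
congr (_ - _); rewrite lnV ?posrE ?sqrtr_gt0 ?mulr_gt0//; congr (- _).
rewrite -lnM ?posrE//.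
have {2}-> : (2 * pi) ^+ m * \det S = Num.sqrt ((2 * pi) ^+ m * \det S) ^+ 2.
  by rewrite sqr_sqrtr// ltW// mulr_gt0.
by rewrite lnXn ?sqrtr_gt0 ?mulr_gt0// mulr2n; field.
Qed.

Lemma gauss_second_moments mu S : posdef S ->
  second_moments lebesgue_cV (gauss mu S) id mu S.
Proof. by move=> pS al be; exact: integral_affine_sqr_gauss. Qed.

Lemma has_integral_gauss_ln mu S1 S2 : posdef S1 -> posdef S2 ->
  has_integral lebesgue_cV
    (fun v => gauss mu S1 v * ln (gauss mu S1 v / gauss 0 S2 v))
    (gauss_KL mu S1 S2).
Proof.
move=> pS1 pS2; have sm := gauss_second_moments mu pS1.
have mg : measurable_fun setT (gauss mu S1) by exact: measurable_gauss.
have g0 := @gauss_ge0 _ _ mu S1.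
have mid : measurable_fun setT (@id 'cV[R]_m) by exact: measurable_id.
(* In the log-ratio the powers of [2 * pi] cancel and two quadratic forms remain. The one of
   [invmx S1], centred at [mu], integrates to the trace of the identity, the source of [m%:R]; the
   one of [invmx S2] is centred at 0. *)
have I1 := second_moments_quad mg g0 mid sm (invmx S1) mu pS1.1.
have I2 := second_moments_quad mg g0 mid sm (invmx S2) 0 pS1.1.
have I0 := second_moments_mass mg g0 mid sm.
have := has_integralD (has_integralZ (2^-1 * (ln (\det S2) - ln (\det S1))) I0)
  (has_integralB (has_integralZ 2^-1 I2) (has_integralZ 2^-1 I1)).
have -> : ((mu - mu)^T *m invmx S1 *m (mu - mu)) 0 0 = 0.
  by rewrite subrr mulmx0 mxE.
rewrite subr0 add0r mulVmx ?posdef_unit// mxtrace1 => H.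
rewrite [X in has_integral _ _ X](_ : _ = 2^-1 * (ln (\det S2) - ln (\det S1)) * 1
  + (2^-1 * ((mu^T *m invmx S2 *m mu) 0 0 + \tr (invmx S2 *m S1)) -
     2^-1 * m%:R)); last by rewrite /gauss_KL; ring.
apply: eq_has_integral H => v.
rewrite ln_div ?posrE ?gauss_gt0// !ln_gauss// subr0; ring.
Qed.

Lemma KL_gauss mu S1 S2 : posdef S1 -> posdef S2 ->
  KL (gauss mu S1) (gauss 0 S2) = (gauss_KL mu S1 S2)%:E.
Proof.
move=> pS1 pS2; rewrite -(has_integral_gauss_ln mu pS1 pS2).2.
apply: eq_integral => v _; rewrite /kl_integrand.
by rewrite !gt_eqF ?gauss_gt0.
Qed.

(* Gibbs: [a * ln (a / b) >= a - b], whose right side integrates to zero. *)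
Lemma gauss_KL_ge0 S1 S2 : posdef S1 -> posdef S2 -> 0 <= gauss_KL 0 S1 S2.
Proof.
move=> pS1 pS2.
have mid : measurable_fun setT (@id 'cV[R]_m) by exact: measurable_id.
have mass S : posdef S -> has_integral lebesgue_cV (gauss (0 : 'cV[R]_m) S) 1.
  move=> pS; apply: second_moments_mass (gauss_second_moments 0 pS) => //.
  - exact: measurable_gauss.
  - exact: gauss_ge0.
rewrite -(subrr (1 : R)).
apply: le_has_integral (has_integralB (mass _ pS1) (mass _ pS2))
  (has_integral_gauss_ln 0 pS1 pS2) => v.
have a0 := gauss_gt0 0 v pS1; have b0 := gauss_gt0 0 v pS2.
set a := gauss 0 S1 v in a0 *; set b := gauss 0 S2 v in b0 *.
rewrite ln_div ?posrE//.
have : ln (b / a) <= b / a - 1.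
  have := @le_ln1Dx _ (b / a - 1).
  by rewrite addrCA subrr addr0; apply; rewrite ltrBrDr addrC subrr divr_gt0.
rewrite ln_div ?posrE// -(ler_pM2l a0) mulrBr.
rewrite mulrBr mulr1 mulrCA divff ?gt_eqF// mulr1; nra.
Qed.

End gaussian_KL.

(** * Rank-one perturbations and the equality case of Gibbs' inequality *)

Section rank_one.
Context {R : realType} {m : nat}.
Implicit Types (z y : 'cV[R]_m) (S M : 'M[R]_m).

Lemma posdef_inv S : posdef S -> posdef (invmx S).
Proof.
move=> pS; have uS := posdef_unit pS; split; first by rewrite trmx_inv pS.1.
move=> v v0.
have y0 : invmx S *m v != 0.
  by apply: contra_neq v0 => /(congr1 (mulmx S)); rewrite mulKVmx// mulmx0.
have := pS.2 _ y0; rewrite trmx_mul trmx_inv pS.1 -!mulmxA mulKVmx//.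
Qed.

Lemma posdef_rank_one S z (t : R) : posdef S -> 0 <= t ->
  posdef (S + t *: (z *m z^T)).
Proof.
move=> [symS S_gt0] t0; split.
  by rewrite linearD linearZ/= symS trmx_mul trmxK.
move=> v /S_gt0 v0; rewrite mulmxDr mulmxDl mxE ltr_wpDr//.
rewrite -scalemxAr -scalemxAl mxE mulr_ge0//.
have -> : v^T *m (z *m z^T) *m v = (z^T *m v)^T *m (z^T *m v).
  by rewrite trmx_mul trmxK !mulmxA.
by rewrite [z^T *m v]mx11_scalar tr_scalar_mx -scalar_mxM mxE eqxx mulr1n sqr_ge0.
Qed.

(** Matrix determinant lemma: the bordered matrix [B] is factored twice, eliminating with its unit
    corner and with [S], and the two determinants are compared. *)
Lemma det_rank_one S z (t : R) : S \in unitmx ->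
  \det (S + t *: (z *m z^T)) = \det S * (1 + t * (z^T *m invmx S *m z) 0 0).
Proof.
move=> uS; set s := (_ *m z) 0 0.
pose B : 'M[R]_(1 + m) := block_mx 1%:M (- t *: z^T) z S.
have BL : B = block_mx 1%:M 0 z 1%:M *m
    block_mx 1%:M (- t *: z^T) 0 (S + t *: (z *m z^T)).
  rewrite mulmx_block !(mul1mx, mulmx1, mul0mx, mulmx0, addr0, add0r).
  by rewrite -scalemxAr [X in X + _]scaleNr addrC addrK.
have BR : B = block_mx (1 + t * s)%:M (- t *: z^T) 0 S *m
    block_mx 1%:M 0 (invmx S *m z) 1%:M.
  rewrite mulmx_block !(mul1mx, mulmx1, mul0mx, mulmx0, addr0, add0r) mulKVmx//.
  rewrite /B; congr block_mx; rewrite -scalemxAl mulmxA [_ *m z]mx11_scalar -/s.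
  by rewrite raddfD/= -scale_scalar_mx scaleNr addrK.
transitivity (\det B).
  by rewrite BL det_mulmx det_lblock det_ublock !det1 !mul1r.
rewrite BR det_mulmx det_lblock det_ublock !det1 !mulr1 det_scalar expr1.
exact: mulrC.
Qed.

(** Sherman-Morrison formula, checked by multiplication: the multiples of [N] cancel exactly because
    [c * (1 + t * s) = t]. *)
Lemma invmx_rank_one S z (t : R) : S \in unitmx ->
  let s := (z^T *m invmx S *m z) 0 0 in 1 + t * s != 0 ->
  invmx (S + t *: (z *m z^T))
  = invmx S - (t / (1 + t * s)) *: (invmx S *m z *m z^T *m invmx S).
Proof.
move=> uS s ts0; apply: invmx_uniq.
set c := t / _; have cE : c * (1 + t * s) = t by rewrite divfK.
pose N := z *m z^T *m invmx S.
have -> : invmx S *m z *m z^T *m invmx S = invmx S *m N by rewrite !mulmxA.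
have SN : S *m (invmx S *m N) = N by rewrite mulKVmx.
have zN : z *m z^T *m (invmx S *m N) = s *: N.
  rewrite /N -!mulmxA (mulmxA (invmx S)) (mulmxA z^T) (mulmxA z^T).
  by rewrite [z^T *m invmx S *m z]mx11_scalar -/s mul_scalar_mx -scalemxAr.
rewrite mulmxDl !mulmxBr mulmxV// -!scalemxAr -!scalemxAl SN zN -/N.
rewrite -addrA -[RHS]addr0; congr (_ + _).
rewrite !scalerA -scaleNr -scalerBl -scalerDl.
by rewrite -[X in _ + (X - _)]cE mulrDr mulr1 mulrA addrK addNr scale0r.
Qed.

Lemma sym_quad_eq S M : S^T = S -> M^T = M ->
  (forall y, (y^T *m S *m y) 0 0 = (y^T *m M *m y) 0 0) -> S = M.
Proof.
move=> symS symM SM; apply/matrixP => i j.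
pose e (k : 'I_m) : 'cV[R]_m := delta_mx k 0.
have ent N k l : ((e k)^T *m N *m e l) 0 0 = N k l.
  by rewrite trmx_delta -rowE -colE !mxE.
have quadD N : ((e i + e j)^T *m N *m (e i + e j)) 0 0
    = N i i + N i j + (N j i + N j j).
  have mxD (K L : 'M[R]_1) : (K + L) 0 0 = K 0 0 + L 0 0 by rewrite mxE.
  by rewrite [(_ + _)^T]linearD !mulmxDl !mulmxDr !mxD !ent; ring.
have := SM (e i + e j); rewrite !quadD.
have := SM (e i); have := SM (e j); rewrite !ent => -> ->.
have -> : S j i = S i j by rewrite -[in LHS]symS mxE.
have -> : M j i = M i j by rewrite -[in LHS]symM mxE.
lra.
Qed.

Lemma le_of_forall_scale (a b c : R) : 0 <= c ->
  (forall t, 0 < t -> a <= b * (1 + t * c)) -> a <= b.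
Proof.
move=> c0 H; have [//|ba] := leP a b.
have [b0|b0] := leP b 0; first by have := H 1 ltr01; nra.
have bc0 : 0 < b * c + 1 by nra.
(* This replaces the limit [t -> 0]: the chosen [t] makes the excess [b * t * c] at most half the
   gap [a - b], a contradiction. Adding 1 keeps the denominator positive when [c = 0]. *)
have := H ((a - b) / 2 / (b * c + 1)).
rewrite !divr_gt0 ?subr_gt0// => /(_ isT).
rewrite mulrDr mulr1.
have : b * ((a - b) / 2 / (b * c + 1) * c) <= (a - b) / 2.
  rewrite (_ : b * _ = (a - b) / 2 * (b * c / (b * c + 1))); last by ring.
  rewrite ler_piMr//; first by rewrite divr_ge0// subr_ge0 ltW.
  by rewrite ler_pdivrMr// mul1r lerDl.
lra.
Qed.

(* By Gibbs' inequality [S] minimizes [ln (\det S') + \tr (invmx S' *m M)] over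
   positive definite [S']: comparing it with the rank-one perturbations of
   [invmx S], respectively of [S], and letting the perturbation vanish, bounds the
   quadratic form of [S] by that of [M], respectively conversely. *)
Lemma gauss_KL_eq0 M S : posdef M -> posdef S -> gauss_KL 0 M S = 0 -> S = M.
Proof.
move=> pM pS KL0.
have uS := posdef_unit pS; have dS := posdef_det_gt0 pS.
have phi S' : posdef S' -> ln (\det S) + \tr (invmx S *m M)
    <= ln (\det S') + \tr (invmx S' *m M).
  move=> pS'; have := gauss_KL_ge0 pM pS'.
  by rewrite -KL0 /gauss_KL trmx0 !mul0mx mxE; lra.
apply: sym_quad_eq pS.1 pM.1 _ => y; apply/eqP; rewrite eq_le; apply/andP; split.
- apply: (@le_of_forall_scale _ _ ((y^T *m S *m y) 0 0)).
    exact: posdef_ge0.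
  move=> t t0; set sg := (y^T *m S *m y) 0 0; set mu := (y^T *m M *m y) 0 0.
  have sg0 : 0 <= sg by exact: posdef_ge0.
  have ts0 : 0 < 1 + t * sg by nra.
  (* Passing from [S] to the inverse of this matrix lowers the log-determinant by [ln (1 + t * sg)]
     and raises the trace by [t * mu], so minimality gives [ln (1 + t * sg) <= t * mu]. Bounding the
     logarithm below by [1 - (1 + t * sg)^-1] yields [sg <= mu * (1 + t * sg)]. *)
  have pQ := posdef_rank_one y (posdef_inv pS) (ltW t0).
  have := phi _ (posdef_inv pQ).
  rewrite invmxK det_inv det_rank_one ?unitmx_inv// invmxK -/sg det_inv.
  rewrite lnV ?posrE ?mulr_gt0 ?invr_gt0// lnM ?posrE ?invr_gt0// lnV ?posrE//.
  rewrite mulmxDl mxtraceD -scalemxAl mxtraceZ -mulmxA.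
  rewrite [\tr (y *m _)]mxtrace_mulC trace_mx11 -/mu => H.
  have : 1 - (1 + t * sg)^-1 <= ln (1 + t * sg).
    have := @le_ln1Dx _ ((1 + t * sg)^-1 - 1).
    rewrite addrCA subrr addr0 lnV ?posrE// => /(_ _).
    by rewrite ltrBrDr addrC subrr invr_gt0 => /(_ ts0); lra.
  have : 1 - (1 + t * sg)^-1 = t * sg / (1 + t * sg) by field; rewrite gt_eqF.
  move=> -> H2.
  have : t * sg / (1 + t * sg) <= t * mu by lra.
  by rewrite ler_pdivrMr// -mulrA ler_pM2l.
(* The factor [S] cancels the inverses in the rank-one formulas: both [z^T *m invmx S *m z] and the
   trace correction become forms in [y], namely [sg] and [mu]. *)
- pose z := S *m y.
  apply: (@le_of_forall_scale _ _ ((y^T *m S *m y) 0 0)).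
    exact: posdef_ge0.
  move=> t t0; set sg := (y^T *m S *m y) 0 0; set mu := (y^T *m M *m y) 0 0.
  have sg0 : 0 <= sg by exact: posdef_ge0.
  have ts0 : 0 < 1 + t * sg by nra.
  have := phi _ (posdef_rank_one z pS (ltW t0)).
  have zE : (z^T *m invmx S *m z) 0 0 = sg.
    by rewrite /z trmx_mul pS.1 -!mulmxA mulKmx// mulmxA.
  rewrite det_rank_one// invmx_rank_one//; last by rewrite zE gt_eqF.
  rewrite zE lnM ?posrE// mulmxBl -scalemxAl -scaleNr mxtraceD mxtraceZ.
  have -> : \tr (invmx S *m z *m z^T *m invmx S *m M) = mu.
    rewrite /z mulKmx// trmx_mul pS.1 -!mulmxA mulKVmx//.
    by rewrite mxtrace_mulC trace_mx11.
  have ln_le : ln (1 + t * sg) <= t * sg by apply: le_ln1Dx; nra.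
  move=> H; have : t * mu / (1 + t * sg) <= t * sg by lra.
  by rewrite ler_pdivrMr// -mulrA ler_pM2l.
Qed.

End rank_one.

(** * Joint law of state and control *)

Lemma integral_indicM d (T : measurableType d) (R : realType)
    (mu : {measure set T -> \bar R}) (W : set T) (q : T -> R) :
  (\int[mu]_(x in W) (q x)%:E = \int[mu]_x (\1_W x * q x)%:E)%E.
Proof.
rewrite integral_mkcond; apply: eq_integral => x _.
by rewrite patchE indicE; case: ifPn => _; rewrite ?mul1r ?mul0r.
Qed.

Section density_measure.
Context d (T : measurableType d) (R : realType)
  (mu : {measure set T -> \bar R}) (p : T -> R)
  (mp : measurable_fun setT p) (p_ge0 : forall x, 0 <= p x).

(** The proofs about [p] are arguments so that the measure structure declared below can be inferred
    from the term itself. *)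
Definition density_measure of measurable_fun setT p & (forall x, 0 <= p x) :=
  fun W : set T => (\int[mu]_(x in W) (p x)%:E)%E.

Local Notation nu := (density_measure mp p_ge0).

Let density0 : nu set0 = 0%E.
Proof. by rewrite /density_measure integral_set0. Qed.

Let density_ge0 W : (0 <= nu W)%E.
Proof. by apply: integral_ge0 => x _; rewrite lee_fin. Qed.

Let density_sigma_additive : semi_sigma_additive nu.
Proof.
move=> F mF tF mUF; rewrite /density_measure ge0_integral_bigcup//.
- by apply: is_cvg_ereal_nneg_natsum_cond => i _ _; exact: density_ge0.
- exact/measurable_EFinP/measurable_funTS.
- by move=> x _; rewrite lee_fin.
Qed.

HB.instance Definition _ := isMeasure.Build _ _ _ nu
  density0 density_ge0 density_sigma_additive.

Import HBNNSimple.

(** Both sides pass to monotone limits of simple functions and are additive, which reduces the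
    identity to indicators, where it is the definition of the measure. *)
Lemma ge0_integral_density_measure (f : T -> R) :
  measurable_fun setT f -> (forall x, 0 <= f x) ->
  (\int[nu]_x (f x)%:E = \int[mu]_x (f x * p x)%:E)%E.
Proof.
move=> mf f0.
have mEf : measurable_fun setT (EFin \o f) by exact/measurable_EFinP.
pose f_ := nnsfun_approx measurableT mEf.
have f_cvg x : (f_ n x)%:E @[n --> \oo] --> (f x)%:E.
  by apply: cvg_nnsfun_approx => // y _; rewrite /= lee_fin.
transitivity (limn (fun n => \int[nu]_x (f_ n x)%:E))%E.
  rewrite -monotone_convergence//.
  - by apply: eq_integral => x _; apply/esym/cvg_lim.
  - by move=> n; exact/measurable_EFinP/measurable_funP.
  - by move=> n y _; rewrite lee_fin.
  - by move=> y _ m n mn; rewrite lee_fin; exact/lefP/nd_nnsfun_approx.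
rewrite [X in limn X](_ : _ = (fun n => \int[mu]_x (f_ n x * p x)%:E)%E).
  rewrite -monotone_convergence//.
  - apply: eq_integral => x _; apply/cvg_lim => //.
    under eq_fun do rewrite EFinM; rewrite EFinM.
    by apply: cvgeZr.
  - by move=> n; apply/measurable_EFinP/measurable_funM.
  - by move=> n y _; rewrite lee_fin mulr_ge0.
  - move=> y _ m n mn; rewrite lee_fin ler_wpM2r//.
    exact/lefP/nd_nnsfun_approx.
apply/funext => n.
transitivity (\sum_(r \in range (f_ n))
    \int[mu]_x (r * \1_(f_ n @^-1` [set r]) x * p x)%:E)%E.
  under eq_integral do rewrite fimfunE -fsumEFin//.
  rewrite ge0_integral_fsum//; last 2 first.
  - by move=> y; exact/measurable_EFinP/measurable_funM.
  - by move=> y x _; rewrite nnfun_muleindic_ge0.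
  apply: eq_fsbigr => r /set_mem [x _ <-].
  rewrite integralZl_indic_nnsfun// integral_indic//= setIT.
  rewrite /density_measure integral_indicM -ge0_integral_EFinZl//.
  - by apply: eq_integral => y _; rewrite mulrA.
  - exact: measurable_funM.
  - by move=> y; rewrite mulr_ge0.
rewrite -ge0_integral_fsum//.
- apply: eq_integral => x _; rewrite fsumEFin//; congr EFin.
  by rewrite [in RHS]fimfunE mulr_fsuml.
- move=> r; apply/measurable_EFinP/measurable_funM => //.
  exact: measurable_funM.
- move=> r x _; rewrite lee_fin mulr_ge0//.
  by have := nnfun_muleindic_ge0 (f_ n) r x; rewrite -EFinM lee_fin.
Qed.

End density_measure.

Section joint_law.
Context d (Omega : measurableType d) (R : realType) (Pr : probability Omega R)
  d1 d2 (T1 : measurableType d1) (T2 : measurableType d2)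
  (lam : {sigma_finite_measure set T2 -> \bar R})
  (x : {RV Pr >-> T1}) (u : {RV Pr >-> T2}) (p : T1 * T2 -> R)
  (mp : measurable_fun setT p) (p0 : forall z, 0 <= p z).

Hypothesis cond_density : forall U V, measurable U -> measurable V ->
  Pr (x @^-1` U `&` u @^-1` V) =
  (\int[Pr]_(w in x @^-1` U) \int[lam]_(v in V) (p (x w, v))%:E)%E.

Let nu := (distribution Pr x \x lam)%E.
Let xu (w : Omega) : T1 * T2 := (x w, u w).

Let mxu : measurable_fun setT xu.
Proof. by apply/measurable_fun_pairP; split. Qed.

Let measurable_inner (f : T1 * T2 -> R) : measurable_fun setT f ->
  (forall z, 0 <= f z) ->
  measurable_fun setT (fun a => \int[lam]_v (f (a, v))%:E)%E.
Proof.
move=> mf f0.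
apply: (@measurable_fun_fubini_tonelli_F _ _ _ _ _ lam (EFin \o f)).
  exact/measurable_EFinP.
by move=> z; rewrite /= lee_fin.
Qed.

Let integral_nu (f : T1 * T2 -> R) : measurable_fun setT f ->
  (forall z, 0 <= f z) ->
  (\int[nu]_z (f z)%:E = \int[Pr]_w \int[lam]_v (f (x w, v))%:E)%E.
Proof.
move=> mf f0; rewrite /nu fubini_tonelli1//=; last exact/measurable_EFinP.
rewrite ge0_integral_distribution//.
- exact: measurable_inner.
- by move=> a; apply: integral_ge0 => v _; rewrite lee_fin.
Qed.

(** The two measures agree on measurable rectangles by [cond_density] and Tonelli. Rectangles are
    stable under intersection, generate the product sigma-algebra and include the whole space, whose
    mass is finite, so agreement extends to all measurable sets. *)
Let joint_lawE W : measurable W ->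
  pushforward Pr xu W = density_measure nu mp p0 W.
Proof.
pose G : set (set (T1 * T2)) :=
  [set C | exists A, measurable A /\ exists B, measurable B /\ C = A `*` B].
apply: (measure_unique G (fun=> setT)) => //.
- rewrite measurable_prod_measurableType; congr (<<s _ >>).
  rewrite predeqE; split => [[A mA [B mB <-]]|[A [mA [B [mB ->]]]]].
    by exists A; split => //; exists B.
  by exists A => //; exists B.
- move=> _ _ [X1 [mX1 [X2 [mX2 ->]]]] [Y1 [mY1 [Y2 [mY2 ->]]]].
  rewrite -setXI; exists (X1 `&` Y1); split; first exact: measurableI.
  by exists (X2 `&` Y2); split => //; exact: measurableI.
- by move=> _; exists setT; split => //; exists setT; rewrite setXTT.
- by rewrite bigcup_const.
- move=> _ [U [mU [V [mV ->]]]].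
  transitivity (\int[nu]_(z in U `*` V) (p z)%:E)%E; last by [].
  rewrite integral_indicM integral_nu; last 2 first.
  + by apply: measurable_funM => //; apply: measurable_indic; exact: measurableX.
  + by move=> z; rewrite mulr_ge0.
  transitivity (Pr (x @^-1` U `&` u @^-1` V)) => //.
  rewrite cond_density// integral_mkcond; apply: eq_integral => w _.
  rewrite patchE; case: ifPn => [/set_mem Ux|/negP Ux].
    rewrite integral_indicM; apply: eq_integral => v _; congr (_ * _)%:E.
    rewrite !indicE; congr ((_ : bool)%:R); apply/idP/idP; rewrite !inE.
      by move=> Vv; split.
    by case.
  rewrite integral0_eq// => v _; rewrite indicE memNset ?mul0r//.
  by case=> Uxw _; apply: Ux; rewrite inE.
- by move=> _; exact: (le_lt_trans (probability_le1 Pr measurableT) (ltry 1)).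
Qed.

Lemma integral_joint (f : T1 * T2 -> R) :
  measurable_fun setT f -> (forall z, 0 <= f z) ->
  (\int[Pr]_w (f (x w, u w))%:E
   = \int[Pr]_w \int[lam]_v (f (x w, v) * p (x w, v))%:E)%E.
Proof.
move=> mf f0.
transitivity (\int[pushforward Pr xu]_z (f z)%:E)%E.
  rewrite (ge0_integral_pushforward mxu)//; first exact/measurable_EFinP.
  by move=> z _; rewrite lee_fin.
rewrite (eq_measure_integral (density_measure nu mp p0)); last first.
  by move=> W mW _; exact: joint_lawE.
rewrite ge0_integral_density_measure// integral_nu//.
- exact: measurable_funM.
- by move=> z; rewrite mulr_ge0.
Qed.

End joint_law.

(** * The controlled process *)

Section process_moments.
Context (R : realType) (T n m : nat)
  (A : 'I_T -> 'M[R]_n) (B : 'I_T -> 'M[R]_(n, m)) (Sini : 'M[R]_n)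
  (hSini : posdef Sini)
  (P : 'I_T -> 'M[R]_(m, n)) (Spi : 'I_T -> 'M[R]_m) (pol : policy R T n m)
  (hpol : P0_with P Spi pol) (Sx : nat -> 'M[R]_n) (hSx0 : Sx 0%N = Sini)
  (hSx : forall k : 'I_T,
    Sx k.+1 = (A k + B k *m P k) *m Sx k *m (A k + B k *m P k)^T
              + B k *m Spi k *m (B k)^T)
  (d : measure_display) (Omega : measurableType d) (Pr : probability Omega R)
  (x : nat -> {RV Pr >-> 'cV[R]_n}) (u : 'I_T -> {RV Pr >-> 'cV[R]_m})
  (hxu : process A B Sini pol x u).

Let Spi_posdef k : posdef (Spi k). Proof. by have [] := hpol k. Qed.

(** Given the state, the control is Gaussian with mean [P k *m x k w]; integrating it out merges [b]
    into the coefficient [a + (P k)^T *m b] of the state and leaves the constant variance of the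
    form [b] under [Spi k]. The choice of [a] and [b] then yields both the state recursion and, with
    [a = 0], the control moments. *)
Let integral_state_control (k : 'I_T) (al : R) (a : 'cV[R]_n) (b : 'cV[R]_m) :
  second_moments Pr (fun=> 1) (x k) 0 (Sx k) ->
  (\int[Pr]_w ((al + (a^T *m x k w) 0 0 + (b^T *m u k w) 0 0) ^+ 2)%:E
   = (al ^+ 2 + ((a + (P k)^T *m b)^T *m Sx k *m (a + (P k)^T *m b)) 0 0
      + (b^T *m Spi k *m b) 0 0)%:E)%E.
Proof.
move=> xk; have polE : pol k = fun y => gauss (P k *m y) (Spi k).
  by have [_ _ polE] := hpol k; apply/funext.
pose f (z : 'cV[R]_n * 'cV[R]_m) :=
  (al + (a^T *m z.1) 0 0 + (b^T *m z.2) 0 0) ^+ 2.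
have mf : measurable_fun setT f.
  apply: measurable_funX; apply: measurable_funD.
    by apply: measurable_affine; exact: measurable_fst.
  apply: measurable_mx_entry; apply: measurable_mxM => //.
pose p (z : 'cV[R]_n * 'cV[R]_m) := gauss (P k *m z.1) (Spi k) z.2.
have mp : measurable_fun setT p.
  apply: measurable_gauss => //; apply: measurable_mxM => //.
rewrite (@integral_joint _ _ _ Pr _ _ _ _ lebesgue_cV (x k) (u k) p mp _ _ f)//;
  last 3 first.
- by move=> z; exact: gauss_ge0.
- by move=> U V mU mV; rewrite (process_control hxu)// polE.
- by move=> z; rewrite sqr_ge0.
pose a' := a + (P k)^T *m b; pose q := (b^T *m Spi k *m b) 0 0.
transitivity (\int[Pr]_w ((al + (a'^T *m x k w) 0 0) ^+ 2 * 1 + q)%:E)%E.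
  apply: eq_integral => w _.
  apply: etrans (integral_affine_sqr_gauss (P k *m x k w)
    (al + (a^T *m x k w) 0 0) b (Spi_posdef k)) _; congr EFin; rewrite mulr1.
  congr (_ ^+ 2 + _); rewrite -addrA; congr (_ + _).
  by rewrite /a' [(_ + _)^T]linearD/= mulmxDl [RHS]mxE trmx_mul trmxK mulmxA.
rewrite ge0_integral_EFinD//.
- rewrite xk integral_cst//= probability_setT mule1 -EFinD; congr EFin.
  by rewrite mulmx0 mxE addr0.
- apply: measurable_funM => //; apply: measurable_funX.
  exact: measurable_affine.
- by move=> w; rewrite mulr1 sqr_ge0.
- by move=> w; exact: posdef_ge0.
Qed.

(** By the dynamics, the form [be] at the next state is the form [A^T be] at the state plus [B^T be]
    at the control, so the recursion for [Sx] is read off from [integral_state_control]. At time 0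
    the moments come from the Gaussian initial density. *)
Lemma process_state_moments k : (k <= T)%N ->
  second_moments Pr (fun=> 1) (x k) 0 (Sx k).
Proof.
elim: k => [_ al be|k IHk kT al be].
  rewrite hSx0.
  transitivity (\int[distribution Pr (x 0%N)]_y
    ((al + (be^T *m y) 0 0) ^+ 2)%:E)%E.
    rewrite ge0_integral_distribution//.
    - by apply: eq_integral => w _; rewrite mulr1.
    - apply/measurable_EFinP; apply: measurable_funX.
      exact: measurable_affine.
    - by move=> y; rewrite lee_fin sqr_ge0.
  have mg : measurable_fun setT (gauss (0 : 'cV[R]_n) Sini).
    exact: measurable_gauss.
  rewrite (eq_measure_integral (density_measure lebesgue_cV mg (gauss_ge0 _ _))).
    rewrite ge0_integral_density_measure ?integral_affine_sqr_gauss//.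
    - by apply: measurable_funX; exact: measurable_affine.
    - by move=> y; rewrite sqr_ge0.
  by move=> U mU _; exact: process_init hxu U mU.
pose k' := Ordinal kT.
transitivity (\int[Pr]_w ((al + (((A k')^T *m be)^T *m x k w) 0 0
  + (((B k')^T *m be)^T *m u k' w) 0 0) ^+ 2)%:E)%E.
  apply: eq_integral => w _; rewrite mulr1; congr (_ ^+ 2)%:E.
  rewrite (process_dynamics hxu k') mulmxDr mxE !trmx_mul !trmxK !mulmxA addrA.
  by [].
rewrite (@integral_state_control k'); last by apply: IHk; exact: ltnW.
congr EFin; rewrite (_ : (be^T *m 0) 0 0 = 0); last by rewrite mulmx0 mxE.
rewrite addr0 -addrA; congr (_ + _).
rewrite (hSx k') mulmxDr mulmxDl [RHS]mxE; congr (_ + _).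
  have -> : (A k')^T *m be + (P k')^T *m ((B k')^T *m be)
      = (A k' + B k' *m P k')^T *m be.
    by rewrite [(_ + _)^T]linearD/= trmx_mul mulmxDl mulmxA.
  by rewrite trmx_mul trmxK !mulmxA.
by rewrite !trmx_mul !trmxK !mulmxA.
Qed.

Lemma process_state_sym k : (k <= T)%N -> (Sx k)^T = Sx k.
Proof.
elim: k => [_|k IHk kT]; first by rewrite hSx0 hSini.1.
rewrite (hSx (Ordinal kT)) linearD/= !trmx_mul !trmxK !mulmxA.
by rewrite (IHk (ltnW kT)) (Spi_posdef (Ordinal kT)).1.
Qed.

Lemma process_control_moments (k : 'I_T) :
  second_moments Pr (fun=> 1) (u k) 0 (Spi k + P k *m Sx k *m (P k)^T).
Proof.
move=> al be.
transitivity (\int[Pr]_w ((al + ((0 : 'cV[R]_n)^T *m x k w) 0 0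
  + (be^T *m u k w) 0 0) ^+ 2)%:E)%E.
  apply: eq_integral => w _; rewrite mulr1; congr ((_ + _) ^+ 2)%:E.
  by rewrite trmx0 mul0mx mxE addr0.
rewrite integral_state_control; last exact/process_state_moments/ltnW.
congr EFin; rewrite (_ : (be^T *m 0) 0 0 = 0); last by rewrite mulmx0 mxE.
rewrite addr0 add0r -addrA; congr (_ + _).
rewrite mulmxDr mulmxDl [RHS]mxE addrC; congr (_ + _).
by rewrite trmx_mul trmxK !mulmxA.
Qed.

Lemma process_prior_posdef (k : 'I_T) :
  posdef (Spi k + P k *m Sx k *m (P k)^T).
Proof.
split.
  rewrite linearD/= !trmx_mul trmxK (Spi_posdef k).1.
  rewrite (process_state_sym (ltnW (ltn_ord k))).
  by rewrite mulmxA.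
move=> v v0; rewrite mulmxDr mulmxDl mxE ltr_wpDr ?(Spi_posdef k).2//.
(* The form of [P k *m Sx k *m (P k)^T] at [v] is the integral of a square, hence nonnegative. *)
have := process_state_moments (ltnW (ltn_ord k)) 0 ((P k)^T *m v).
rewrite mulmx0 mxE add0r expr0n add0r trmx_mul trmxK !mulmxA => xk.
rewrite -lee_fin -xk; apply: integral_ge0 => w _.
by rewrite lee_fin mulr1 sqr_ge0.
Qed.

End process_moments.

(** * The cost as a function of the prior covariances *)

Lemma gauss_KL_refl (R : realType) m (M : 'M[R]_m) : posdef M ->
  gauss_KL 0 M M = 0.
Proof.
move=> pM; rewrite /gauss_KL trmx0 !mul0mx mxE mulVmx ?posdef_unit//.
by rewrite mxtrace1; ring.
Qed.

Section cost.
Context (R : realType) (T n m : nat)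
  (A : 'I_T -> 'M[R]_n) (B : 'I_T -> 'M[R]_(n, m)) (Sini : 'M[R]_n)
  (hSini : posdef Sini)
  (P : 'I_T -> 'M[R]_(m, n)) (Spi : 'I_T -> 'M[R]_m) (pol : policy R T n m)
  (hpol : P0_with P Spi pol) (Sx : nat -> 'M[R]_n) (hSx0 : Sx 0%N = Sini)
  (hSx : forall k : 'I_T,
    Sx k.+1 = (A k + B k *m P k) *m Sx k *m (A k + B k *m P k)^T
              + B k *m Spi k *m (B k)^T)
  (d : measure_display) (Omega : measurableType d) (Pr : probability Omega R)
  (x : nat -> {RV Pr >-> 'cV[R]_n}) (u : 'I_T -> {RV Pr >-> 'cV[R]_m})
  (hxu : process A B Sini pol x u).

Let M (k : 'I_T) : 'M[R]_m := Spi k + P k *m Sx k *m (P k)^T.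

Let has_integral_sqnorm2 (k : 'I_T) :
  has_integral Pr (fun w => sqnorm2 (u k w)) (\tr (M k)).
Proof.
have pM := process_prior_posdef hSini hpol hSx0 hSx hxu k.
have mu : measurable_fun [set: Omega] (u k) by exact: measurable_funP.
have := second_moments_quad (measurable_cst (1 : R)) (fun=> ler01)
  mu (process_control_moments hSini hpol hSx0 hSx hxu k)
  1%:M 0 pM.1.
rewrite !subr0 mul1mx mulmx0 mxE add0r; apply: eq_has_integral => w.
rewrite mulr1 subr0 mulmx1 mxE; apply: eq_bigr => i _.
by rewrite mxE expr2.
Qed.

(** Averaging the mean term over the state completes [\tr (invmx S *m Spi k)] to
    [\tr (invmx S *m M k)]. The remaining half difference of log-determinants is the Gaussian mutual
    information of state and control, the same for every [S]. *)
Let has_integral_gauss_KL (k : 'I_T) (S : 'M[R]_m) : posdef S ->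
  has_integral Pr (fun w => gauss_KL (P k *m x k w) (Spi k) S)
    (gauss_KL 0 (M k) S + 2^-1 * (ln (\det (M k)) - ln (\det (Spi k)))).
Proof.
move=> pS; have kT := ltnW (ltn_ord k).
have xk := process_state_moments hSini hpol hSx0 hSx hxu kT.
have sx := process_state_sym hSini hpol hSx0 hSx kT.
have mx : measurable_fun [set: Omega] (x k) by exact: measurable_funP.
have m1 : measurable_fun [set: Omega] (fun=> 1 : R) by exact: measurable_cst.
have Iq := second_moments_quad m1 (fun=> ler01) mx xk
  ((P k)^T *m invmx S *m P k) 0 sx.
have I1 := second_moments_mass m1 (fun=> ler01) mx xk.
have := has_integralZ 2^-1 (has_integralD (has_integralZ
  (ln (\det S) - ln (\det (Spi k)) + \tr (invmx S *m Spi k) - m%:R) I1) Iq).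
have -> : (((0 : 'cV[R]_n) - 0)^T *m ((P k)^T *m invmx S *m P k)
    *m ((0 : 'cV[R]_n) - 0)) 0 0 = 0.
  by rewrite subr0 mulmx0 mxE.
have trE : \tr ((P k)^T *m invmx S *m P k *m Sx k)
    = \tr (invmx S *m M k) - \tr (invmx S *m Spi k).
  rewrite /M mulmxDr mxtraceD addrAC subrr add0r -!mulmxA mxtrace_mulC.
  by rewrite !mulmxA.
rewrite trE add0r mulr1 => H.
rewrite (_ : gauss_KL 0 (M k) S + _ = 2^-1 * (ln (\det S) - ln (\det (Spi k))
  + \tr (invmx S *m Spi k) - m%:R
  + (\tr (invmx S *m M k) - \tr (invmx S *m Spi k)))); last first.
  by rewrite /gauss_KL trmx0 !mul0mx mxE; ring.
apply: eq_has_integral H => w; rewrite /gauss_KL !mulr1 subr0.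
by rewrite trmx_mul !mulmxA; ring.
Qed.

Lemma cost_gauss : exists C : R,
  forall (rho : prior R T m) (S : 'I_T -> 'M[R]_m),
  (forall k, posdef (S k) /\ rho k = gauss 0 (S k)) ->
  J x u pol rho = (C + \sum_(k < T) gauss_KL 0 (M k) (S k))%:E.
Proof.
(* Expected control energy plus mutual information at each time; it is fixed before the prior is
   chosen. *)
exists (\sum_(k < T) (2^-1 * \tr (M k)
  + 2^-1 * (ln (\det (M k)) - ln (\det (Spi k))))) => rho S rhoS.
have := has_integral_sum (index_enum 'I_T) (fun k =>
  has_integralD (has_integralZ 2^-1 (has_integral_sqnorm2 k))
    (has_integral_gauss_KL k (rhoS k).1)).
move=> [_ H]; rewrite -big_split /J.
under [in RHS]eq_bigr => k _ do rewrite /= -addrA [X in _ + X]addrC.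
rewrite -H; apply: eq_integral => w _; rewrite -sumEFin.
apply: eq_bigr => k _; rewrite EFinD; congr (_ + _)%E.
have [pSpi _ ->] := hpol k; rewrite (rhoS k).2.
by rewrite KL_gauss//; have [] := rhoS k.
Qed.

End cost.

Theorem theorem16 (R : realType) (T n m : nat) (hT : (1 <= T)%N)
    (A : 'I_T -> 'M[R]_n) (B : 'I_T -> 'M[R]_(n, m))
    (Sini : 'M[R]_n) (hSini : posdef Sini)
    (P : 'I_T -> 'M[R]_(m, n)) (Spi : 'I_T -> 'M[R]_m)
    (pol : policy R T n m) (hpol : P0_with P Spi pol)
    (Sx : nat -> 'M[R]_n) (hSx0 : Sx 0%N = Sini)
    (hSx : forall k : 'I_T,
      Sx k.+1 = (A k + B k *m P k) *m Sx k *m (A k + B k *m P k)^T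
                + B k *m Spi k *m (B k)^T)
    (d : measure_display) (Omega : measurableType d) (Pr : probability Omega R)
    (x : nat -> {RV Pr >-> 'cV[R]_n}) (u : 'I_T -> {RV Pr >-> 'cV[R]_m})
    (hxu : process A B Sini pol x u) :
  unique_minimizer (J x u pol) (@R0 R T m)
    (fun k : 'I_T => gauss 0 (Spi k + P k *m Sx k *m (P k)^T)).
Proof.
pose M (k : 'I_T) : 'M[R]_m := Spi k + P k *m Sx k *m (P k)^T.
have pM (k : 'I_T) : posdef (M k) :=
  process_prior_posdef hSini hpol hSx0 hSx hxu k.
have [C JE] := cost_gauss hSini hpol hSx0 hSx hxu.
have JM : J x u pol (fun k => gauss 0 (M k)) = C%:E.
  by rewrite (JE _ M)// big1 ?addr0// => k _; exact: (gauss_KL_refl (pM k)).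
have KL_ge0 (S : 'I_T -> 'M[R]_m) k : posdef (S k) -> 0 <= gauss_KL 0 (M k) (S k).
  by move=> pS; exact: gauss_KL_ge0.
have R0M : @R0 R T m (fun k => gauss 0 (M k)).
  by exists M => k; split => //; exact: pM.
split; first exact: R0M.
- move=> rho [S rhoS]; rewrite JM (JE _ S)// lee_fin lerDl.
  by apply: sumr_ge0 => k _; apply: KL_ge0; exact: (rhoS k).1.
(* Comparing [rho] with the candidate alone is enough: the candidate costs [C], so the nonnegative
   divergences of [rho] sum to at most zero and each of them vanishes. *)
- move=> rho [S rhoS] /(_ _ R0M); rewrite JM (JE _ S)// lee_fin gerDl => sum_le0.
  have S_ge0 (k : 'I_T) (_ : true) : 0 <= gauss_KL 0 (M k) (S k).
    by apply: KL_ge0; exact: (rhoS k).1.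
  have sum0 : \sum_(k < T) gauss_KL 0 (M k) (S k) = 0.
    by apply/eqP; rewrite eq_le sum_le0 sumr_ge0.
  have KL0 := psumr_eq0P S_ge0 sum0.
  apply/funext => k; have [pS ->] := rhoS k.
  by rewrite (gauss_KL_eq0 (pM k) pS (KL0 k isT)).
Qed.
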